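(* Assume $2\le|\mathcal U_{\mathcal E}|\le T$ and set $T_1\ge\sqrt{|\mathcal U_{\mathcal E}|T}$. Then for every instance $\nu\in\mathcal E_0$, UCB-TSN guarantees $$e_\nu(T,\hat\Delta)\sqrt{\mathcal R_\nu(T,\pi)}=\tilde O\big(\sqrt{|\mathcal U_{\mathcal E}|}\big).$$
   Context: Bandit with network interference: arm set $\mathcal K=[K]$, units $\mathcal U=[N]$, horizon $T$, fixed adjacency matrix $\mathbb H$. Choosing a super arm $A\in\mathcal K^{\mathcal U}$ in round $t$ yields for each unit $i$ the reward $r_{i,t}(A)=Y_i(A)+\eta_{i,t}$ with unknown $Y_i(A)\in[0,1]$ and i.i.d. zero-mean 1-sub-Gaussian noise; an instance $\nu$ is an admissible choice of the reward distributions and $\mathcal E_0$ is the set of instances. A fixed exposure mapping $\mathbf S:\mathcal U\times\mathcal K^{\mathcal U}\times\{\mathbb H\}\to\mathcal U_s$ assigns to $A$ the exposure super arm $(\mathbf S(i,A,\mathbb H))_i$. With a fixed partition $\mathcal C$ of $[N]$ into clusters, $\mathcal U_{\mathcal C}$ = exposure vectors constant on clusters, $\mathcal U_{\mathcal O}$ = exposure vectors realized by some $A$, $\mathcal U_{\mathcal E}=\mathcal U_{\mathcal C}\cap\mathcal U_{\mathcal O}$. For $S\in\mathcal U_{\mathcal E}$, $\tilde Y_i(S)=\sum_AY_i(A)\mathbb P(A\mid S)$ with $\mathbb P(\cdot\mid S)$ uniform over super arms with exposure super arm $S$; $\tilde r_{i,t}(S)$ is the reward of such a uniformly drawn $A$.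 Regret $\mathcal R_\nu(T,\pi)=\frac TN\sum_i\tilde Y_i(S^* )-\frac1N\mathbb E_\pi[\sum_{t\le T}\sum_i\tilde r_{i,t}(S_t)]$, $S^*\in\arg\max_{S\in\mathcal U_{\mathcal E}}\sum_i\tilde Y_i(S)$. ATE $\Delta^{(i,j)}=\frac1N\sum_{i'}(\tilde Y_{i'}(S_i)-\tilde Y_{i'}(S_j))$; error $e_\nu(T,\hat\Delta)=\max_{S_i,S_j\in\mathcal U_{\mathcal E}}\mathbb E|\Delta^{(i,j)}-\hat\Delta^{(i,j)}_T|$. Algorithm UCB-TSN (parameters $T_1\le T$, $\delta$): Sampling$(S)$ draws $A$ uniformly among super arms with exposure super arm $S$, pulls it and records $\tilde r_{i,t}(S)=r_{i,t}(A)$. $\mathcal N^t_S$ = number of rounds $t'\le t$ with $S_{t'}=S$; $\hat R_t(S)$ = average of $\frac1N\sum_i\tilde r_{i,t'}(S_{t'})$ over those rounds. Phase 1 ($t\le T_1$): round-robin over $\mathcal U_{\mathcal E}$ via Sampling; output $\hat\Delta^{(i,j)}_T=\hat R_{T_1}(S_i)-\hat R_{T_1}(S_j)$. Phase 2 ($T_1<t\le T$): play $\arg\max_S(\hat R_{t-1}(S)+\sqrt{9\log(1/\delta)/\mathcal N^{t-1}_S})$ via Sampling. (Elsewhere the paper uses $\delta=1/T^2$.) $\tilde O$ hides polylogarithmic factors; orders in $K,T$. *)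

(* Defs.v *)
From HB Require Import structures.
From mathcomp Require Import all_boot all_order all_algebra.
From mathcomp Require Import all_classical all_reals all_analysis.

Set Implicit Arguments.
Unset Strict Implicit.
Unset Printing Implicit Defensive.

Import Order.TTheory GRing.Theory Num.Theory.
Import numFieldNormedType.Exports.
Local Open Scope classical_set_scope.
Local Open Scope ring_scope.

(* Arms K = 'I_K, units U = 'I_N, super arm = {ffun 'I_N -> 'I_K},     *)
(* exposure values Us (a finType), exposure super arm = {ffun 'I_N -> Us}. *)
(* The exposure mapping is S : 'I_N -> super arm -> 'M[R]_N -> Us,    *)
(* evaluated at the fixed adjacency matrix H.                           *)

Section Exposure.
Variables (R : realType) (K N : nat) (Us : finType).
Variable (S : 'I_N -> {ffun 'I_N -> 'I_K} -> 'M[R]_N -> Us).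
Variable (H : 'M[R]_N).

Definition expo (A : {ffun 'I_N -> 'I_K}) : {ffun 'I_N -> Us} :=
  [ffun i => S i A H].

Definition preim (s : {ffun 'I_N -> Us}) : seq {ffun 'I_N -> 'I_K} :=
  [seq A <- enum {ffun 'I_N -> 'I_K} | expo A == s].

Definition U_C (Cl : {set {set 'I_N}}) : {set {ffun 'I_N -> Us}} :=
  [set s : {ffun 'I_N -> Us} | [forall c in Cl, forall i in c, forall j in c, s i == s j]].

Definition U_O : {set {ffun 'I_N -> Us}} :=
  [set s : {ffun 'I_N -> Us} | [exists A, expo A == s]].

Definition U_E (Cl : {set {set 'I_N}}) : {set {ffun 'I_N -> Us}} :=
  U_C Cl :&: U_O.

(* tilde Y_i(s) = sum_A Y_i(A) P(A | s), P(.|s) uniform on preim s *)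
Definition Ytil (Y : {ffun 'I_N -> 'I_K} -> 'I_N -> R)
  (s : {ffun 'I_N -> Us}) (i : 'I_N) : R :=
  (\sum_(A <- preim s) Y A i) / (size (preim s))%:R.

Definition meanY (Y : {ffun 'I_N -> 'I_K} -> 'I_N -> R)
  (s : {ffun 'I_N -> Us}) : R :=
  N%:R^-1 * \sum_(i < N) Ytil Y s i.

Definition ATE (Y : {ffun 'I_N -> 'I_K} -> 'I_N -> R)
  (s1 s2 : {ffun 'I_N -> Us}) : R :=
  N%:R^-1 * \sum_(i < N) (Ytil Y s1 i - Ytil Y s2 i).

(* Sampling(s): draw A uniformly among preim s, using a uniform [0,1)
   variable u: the truncn (u * |preim s|)-th element. *)
Definition draw (s : {ffun 'I_N -> Us}) (u : R) : option {ffun 'I_N -> 'I_K} :=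
  match preim s with
  | [::] => None
  | a :: _ => Some (nth a (preim s) (Num.truncn (u * (size (preim s))%:R)))
  end.

Definition round_reward (Y : {ffun 'I_N -> 'I_K} -> 'I_N -> R)
  (eta_t : 'I_N -> R) (s : {ffun 'I_N -> Us}) (u : R) : R :=
  match draw s u with
  | None => 0
  | Some A => N%:R^-1 * \sum_(i < N) (Y A i + eta_t i)
  end.

(* The algorithm UCB-TSN.  A history is the list of pairs             *)
(* (S_t', (1/N) sum_i tilde r_{i,t'}(S_t')) for the past rounds.       *)

Definition cntS (h : seq ({ffun 'I_N -> Us} * R)) (s : {ffun 'I_N -> Us}) : nat :=
  count (fun p => p.1 == s) h.

Definition Rhat (h : seq ({ffun 'I_N -> Us} * R)) (s : {ffun 'I_N -> Us}) : R :=
  (\sum_(p <- h | p.1 == s) p.2) / (cntS h s)%:R.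

Definition argmax_seq (f : {ffun 'I_N -> Us} -> R) (s0 : {ffun 'I_N -> Us})
  (l : seq {ffun 'I_N -> Us}) : {ffun 'I_N -> Us} :=
  foldl (fun best s => if f best < f s then s else best) (head s0 l) (behead l).

(* exposure super arm chosen in round t (t >= 1), given the history h of
   rounds 1..t-1.  ord is the round-robin order of U_E, s0 an (unused
   when ord <> [::]) default, delta the confidence parameter. *)
Definition ucb_choice (T1 : nat) (delta : R) (s0 : {ffun 'I_N -> Us})
  (ord : seq {ffun 'I_N -> Us}) (t : nat) (h : seq ({ffun 'I_N -> Us} * R))
  : {ffun 'I_N -> Us} :=
  if (t <= T1)%N then nth s0 ord ((t - 1) %% size ord)
  else argmax_seq
         (fun s => Rhat h s + Num.sqrt (9 * ln (delta^-1) / (cntS h s)%:R))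
         s0 ord.

Variables (Omega : Type).

Fixpoint ucb_hist (Y : {ffun 'I_N -> 'I_K} -> 'I_N -> R)
  (eta : 'I_N -> nat -> Omega -> R) (unif : nat -> Omega -> R)
  (T1 : nat) (delta : R) (s0 : {ffun 'I_N -> Us})
  (ord : seq {ffun 'I_N -> Us}) (t : nat) (w : Omega)
  : seq ({ffun 'I_N -> Us} * R) :=
  match t with
  | 0 => [::]
  | t'.+1 =>
      let h := ucb_hist Y eta unif T1 delta s0 ord t' w in
      let s := ucb_choice T1 delta s0 ord t h in
      rcons h (s, round_reward Y (fun i => eta i t w) s (unif t w))
  end.

End Exposure.

Definition mutually_independent {d} {Omega : measurableType d} {R : realType}
  (P : probability Omega R) (J : eqType) (Z : J -> Omega -> R) : Prop :=
  forall (F : seq J) (B : J -> set R), uniq F ->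
    (forall j, measurable (B j)) ->
    P (\bigcap_(j in [set` F]) (Z j @^-1` B j)) =
    (\prod_(j <- F) P (Z j @^-1` B j))%E.

Definition subgaussian1 {d} {Omega : measurableType d} {R : realType}
  (P : probability Omega R) (X : Omega -> R) : Prop :=
  measurable_fun setT X /\
  (\int[P]_w (X w)%:E = 0)%E /\
  forall lam : R, (\int[P]_w (expR (lam * X w))%:E <= (expR (lam ^+ 2 / 2))%:E)%E.

Definition uniform01 {d} {Omega : measurableType d} {R : realType}
  (P : probability Omega R) (X : Omega -> R) : Prop :=
  measurable_fun setT X /\
  forall x : R, 0 <= x <= 1 -> P [set w | X w < x] = x%:E.

Definition Exp {d} {Omega : measurableType d} {R : realType}
  (P : probability Omega R) (X : Omega -> R) : R :=
  fine (\int[P]_w (X w)%:E)%E.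

(* Main.v *)
(* For a function lam of the arm, the process
     M_t = exp (sum_(r <= t) [lam(S_r) (X_r - mu(S_r)) - (3/2) lam(S_r)^2])
   is a nonnegative supermartingale with E M_t <= 1: the reward X_r of a fixed
   arm is independent of the past, and its moment generating function is at
   most exp(lam^2) (uniform draw of a super arm, Hoeffding) times
   exp(lam^2 / 2) (average of the noises).  Every probabilistic estimate is
   then a pathwise inequality whose right-hand side is a combination of such
   weights, integrated term by term:
   - |x| <= e^x + e^-x with lam = +- 1/sqrt m on one arm bounds the estimation
     error of an arm pulled m times by O(1/sqrt m), and round robin gives
     m >= T1 / (2 |U_E|);
   - a deviation of Rhat beyond the UCB bonus forces one of the weights to be
     at least T^3, hence the phase-2 regret is at most
     O(sqrt(|U_E| T ln T)) plus T^-3 times a sum of at most 4 T^3 weights;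
   - lam = -1/sqrt T on all arms bounds the gap between pseudo-regret and
     regret by O(sqrt T).
   As T1 >= sqrt(|U_E| T), the regret is O(T1 (ln T)^2) and the error is
   O(sqrt(|U_E| / T1)). *)
Require Import Defs.
From HB Require Import structures.
From mathcomp Require Import all_boot all_order all_algebra.
From mathcomp Require Import all_classical all_reals all_analysis.
From mathcomp Require Import measurable_realfun ring lra zify.
Import Order.TTheory GRing.Theory Num.Theory.
Import numFieldNormedType.Exports.
Local Open Scope classical_set_scope.
Local Open Scope ring_scope.

Set Implicit Arguments.
Unset Strict Implicit.
Unset Printing Implicit Defensive.


(** * Independence: integrals of products and the sigma-algebra of the past *)

(** The joint law agrees with the product of the marginal laws on rectangles, hence on all
    measurable sets, and Tonelli separates the two integrals. *)
Lemma ge0_integralM_indep {d1 d2 d3} {Omega : measurableType d1}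
    {T1 : measurableType d2} {T2 : measurableType d3} {R : realType}
    (P : probability Omega R) (X : Omega -> T1) (Z : Omega -> T2)
    (f : T1 -> R) (g : T2 -> R) :
  measurable_fun setT X -> measurable_fun setT Z ->
  (forall A B, measurable A -> measurable B ->
    P (X @^-1` A `&` Z @^-1` B) = (P (X @^-1` A) * P (Z @^-1` B))%E) ->
  measurable_fun setT f -> measurable_fun setT g ->
  (forall x, 0 <= f x) -> (forall z, 0 <= g z) ->
  (\int[P]_w (f (X w) * g (Z w))%:E =
   \int[P]_w (f (X w))%:E * \int[P]_w (g (Z w))%:E)%E.
Proof.
move=> mX mZ ind mf mg f0 g0.
pose X' : {mfun Omega >-> T1} := HB.pack X (isMeasurableFun.Build _ _ _ _ _ mX).
pose Z' : {mfun Omega >-> T2} := HB.pack Z (isMeasurableFun.Build _ _ _ _ _ mZ).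
have mXZ : measurable_fun setT (fun w => (X w, Z w)) by exact: measurable_fun_pair.
pose W : {mfun Omega >-> (T1 * T2)%type} :=
  HB.pack (fun w => (X w, Z w)) (isMeasurableFun.Build _ _ _ _ _ mXZ).
pose F (p : T1 * T2) := (f p.1 * g p.2)%:E.
have mF : measurable_fun (setT : set (T1 * T2)%type) (F : _ -> \bar R).
  apply/measurable_EFinP; apply: measurable_funM; exact: measurableT_comp.
have F0 p : (0 <= F p)%E by rewrite lee_fin mulr_ge0.
transitivity (\int[distribution P W]_p F p)%E.
  by rewrite ge0_integral_distribution.
transitivity (\int[distribution P X' \x distribution P Z']_p F p)%E.
  apply: eq_measure_integral => A mA _.
  apply/esym; apply: product_measure_unique => [B C mB mC|]; last exact: mA.
  exact: ind.
transitivity (\int[distribution P X']_x \int[distribution P Z']_z F (x, z))%E.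
  exact: fubini_tonelli1.
rewrite /F /=.
under eq_integral.
  move=> x _; under eq_integral do rewrite EFinM.
  rewrite ge0_integralZl//; last 3 first.
  - exact/measurable_EFinP.
  - by move=> z _; rewrite lee_fin.
  - by rewrite lee_fin.
  over.
rewrite ge0_integralZr//; last 3 first.
- exact/measurable_EFinP.
- by move=> z _; rewrite lee_fin.
- by apply: integral_ge0 => z _; rewrite lee_fin.
rewrite (ge0_integral_distribution X' (f:=fun x => (f x)%:E))//; last first.
  exact/measurable_EFinP.
by rewrite (ge0_integral_distribution Z' (f:=fun x => (g x)%:E))//; exact/measurable_EFinP.
Qed.

Section Cylinders.
Context {d} {Omega : measurableType d} {R : realType} (P : probability Omega R).
Context {J : eqType} (Z : J -> Omega -> R).

(** The pi-system generating the sigma-algebra of the variables indexed by [F]. Its shape is the one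
    on which [mutually_independent] gives a product formula. *)
Definition cylinders (F : seq J) : set (set Omega) :=
  [set A | exists2 B : J -> set R, (forall j, measurable (B j)) &
    A = \bigcap_(j in [set` F]) (Z j @^-1` B j)].

Lemma cylinders_setI F : setI_closed (cylinders F).
Proof.
move=> _ _ [B mB ->] [C mC ->]; exists (fun j => B j `&` C j).
  by move=> j; exact: measurableI.
by rewrite -bigcapI.
Qed.

Lemma measurable_cylinder_coord F j : j \in F ->
  measurable_fun (setT : set (g_sigma_algebraType (cylinders F))) (Z j).
Proof.
move=> jF _ B mB; rewrite setTI; apply: sub_sigma_algebra.
exists (fun k => if k == j then B else setT).
  by move=> k; case: ifP.
apply/seteqP; split => [w Bw k /= kF|w /(_ j jF)]; last by rewrite eqxx.
by case: eqP => // ->.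
Qed.

Hypothesis mZ : forall j, measurable_fun setT (Z j).

Lemma cylinders_measurable F : cylinders F `<=` measurable.
Proof.
move=> _ [B mB ->]; apply: fin_bigcap_measurable => // j _.
by rewrite -[X in measurable X]setTI; exact: mZ.
Qed.

Lemma sigma_cylinders_measurable F : <<s cylinders F >> `<=` measurable.
Proof.
by apply: smallest_sub; [exact: sigma_algebra_measurable|exact: cylinders_measurable].
Qed.

Lemma measurable_fun_cylinders {d'} {T : measurableType d'} F (f : Omega -> T) :
  measurable_fun (setT : set (g_sigma_algebraType (cylinders F))) f ->
  measurable_fun setT f.
Proof.
move=> mf _ B mB; rewrite setTI; apply: (@sigma_cylinders_measurable F).
by have := mf measurableT B mB; rewrite setTI.
Qed.

Hypothesis indZ : mutually_independent P Z.

(** Both sides are finite measures in [A]; mutual independence makes them agree on the cylinders,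
    and a pi-system determines a finite measure on the sigma-algebra it generates. *)
Lemma cylinders_indep F j A B : uniq F -> j \notin F ->
  <<s cylinders F >> A -> measurable B ->
  P (A `&` Z j @^-1` B) = (P A * P (Z j @^-1` B))%E.
Proof.
move=> uF jF sA mB.
have mE : measurable (Z j @^-1` B) by rewrite -[X in measurable X]setTI; exact: mZ.
set E := Z j @^-1` B in mE *.
have PE0 : 0 <= fine (P E) by exact: fine_ge0.
rewrite -[LHS]/(mrestr P mE A).
rewrite muleC -[P E]fineK ?fin_num_measure// -[RHS]/(mscale (NngNum PE0) P A).
apply: (g_sigma_algebra_measure_unique (cylinders F) _ (fun=> setT)) => //.
- exact: cylinders_measurable.
- move=> _; exists (fun=> setT) => //.
  by apply/seteqP; split.
- by rewrite bigcup_const.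
- exact: cylinders_setI.
- move=> _ [C mC ->] /=.
  rewrite /mrestr /mscale /= fineK ?fin_num_measure// indZ// muleC.
  (* A cylinder over [F] cut by the event on [j] is a cylinder over [j :: F]; since [j] is not in
     [F], overwriting the coordinate [j] changes no constraint of [C] on [F]. *)
  pose C' k := if k == j then B else C k.
  have mC' k : measurable (C' k) by rewrite /C'; case: ifP.
  have e k : k \in F -> C' k = C k.
    by rewrite /C'; case: eqP => // ->; rewrite (negbTE jF).
  transitivity (P (\bigcap_(k in [set` j :: F]) (Z k @^-1` C' k))).
    congr (P _); rewrite setIC; apply/seteqP; split => [w [Ew Cw] k /=|w Cw].
      rewrite inE => /orP[/eqP ->|kF]; first by rewrite /C' eqxx.
      by rewrite e//; exact: Cw.
    split; first by have := Cw j; rewrite /= inE eqxx /C' eqxx; exact.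
    by move=> k kF; rewrite /= -e//; apply: Cw; rewrite /= inE kF orbT.
  rewrite indZ//= ?jF// big_cons /C' eqxx muleC; congr (_ * _)%E.
  by apply: eq_big_seq => k kF; have := e k kF; rewrite /C' => ->.
- by move=> _; rewrite /= /mrestr setTI ltey_eq fin_num_measure.
Qed.

(** Induction on [L]: the factor of the head [j] is absorbed into [f], which becomes measurable for
    [j :: F]; once the other factors are bounded, independence of [j] from [F] splits off its
    integral. *)
Lemma integral_fresh_le F L (f : Omega -> R) (phi : J -> R -> R) (c : J -> R) :
  uniq (L ++ F) ->
  measurable_fun (setT : set (g_sigma_algebraType (cylinders F))) f ->
  (forall w, 0 <= f w) ->
  (forall j, measurable_fun setT (phi j)) -> (forall j x, 0 <= phi j x) ->
  (forall j, 0 <= c j) ->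
  (forall j, j \in L -> (\int[P]_w (phi j (Z j w))%:E <= (c j)%:E)%E) ->
  (\int[P]_w (f w * \prod_(j <- L) phi j (Z j w))%:E
     <= (\prod_(j <- L) c j)%:E * \int[P]_w (f w)%:E)%E.
Proof.
move=> + + + mphi phi0 c0; elim: L F f => [|j L IH] F f uLF mf f0 hc.
  rewrite big_nil mul1e.
  by under eq_integral do rewrite big_nil mulr1.
move: uLF => /= /andP[]; rewrite mem_cat negb_or => /andP[jL jF] uLF.
under eq_integral do rewrite big_cons mulrA.
have uLF' : uniq (L ++ j :: F).
  have /perm_uniq -> : perm_eq (L ++ j :: F) (j :: L ++ F).
    by rewrite -[j :: F]cat1s perm_catCA.
  by rewrite /= mem_cat negb_or jL jF.
apply: (le_trans (IH (j :: F) (fun w => f w * phi j (Z j w)) uLF' _ _ _)).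
- apply: measurable_funM.
    move=> _ B mB; rewrite setTI.
    have := mf measurableT B mB; rewrite setTI.
    move: (f @^-1` B); apply: smallest_sub.
      exact: sigma_algebra_measurable.
    move=> _ [C mC ->]; apply: sub_sigma_algebra.
    exists (fun k => if k \in F then C k else setT); first by move=> k; case: ifP.
    apply/seteqP; split => [w Cw k /=|w Cw k /= kF].
      by case: ifPn => // kF _; exact: Cw.
    by have := Cw k; rewrite /= inE kF orbT; exact.
  apply: measurableT_comp => //; apply: measurable_cylinder_coord.
  by rewrite inE eqxx.
- by move=> w; rewrite mulr_ge0.
- by move=> k kL; apply: hc; rewrite inE kL orbT.
rewrite big_cons mulrC EFinM -muleA lee_wpmul2l//.
  by rewrite lee_fin prodr_ge0.
have uF : uniq F by move: uLF; rewrite cat_uniq => /and3P[].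
have -> : (\int[P]_w (f w * phi j (Z j w))%:E =
    \int[P]_w (f w)%:E * \int[P]_w (phi j (Z j w))%:E)%E.
  apply: (@ge0_integralM_indep _ _ _ Omega (g_sigma_algebraType (cylinders F)) _ _ P idfun (Z j)) => //.
  - move=> _ B mB; rewrite setTI; exact: (@sigma_cylinders_measurable F).
  - by move=> A B mA mB; apply: (cylinders_indep uF).
rewrite muleC lee_wpmul2r//; first by apply: integral_ge0 => w _; rewrite lee_fin.
by apply: hc; rewrite inE eqxx.
Qed.

End Cylinders.


(** * Measurability of arm choices, rewards and histories *)

Lemma measurable_fun_of_nat {d} {T : measurableType d} {R : realType}
    (m : T -> nat) (phi : nat -> R) :
  measurable_fun setT (fun w => (m w)%:R : R) ->
  measurable_fun setT (fun w => phi (m w)).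
Proof.
move=> mm _ B mB; rewrite setTI.
rewrite (_ : _ @^-1` _ = \bigcup_(k in phi @^-1` B)
    (fun w => (m w)%:R : R) @^-1` [set k%:R]); last first.
  apply/seteqP; split => [w /= Bw|w [k /= Bk]]; first by exists (m w).
  by move/eqP; rewrite eqr_nat => /eqP ->.
apply: bigcup_measurable => k _.
by have := mm measurableT [set k%:R] (measurable_set1 _); rewrite setTI.
Qed.

Lemma measurable_fun_truncn {R : realType} :
  measurable_fun setT (fun x : R => (Num.truncn x)%:R : R).
Proof.
apply: nondecreasing_measurable => // x y xy; rewrite ler_nat.
have [x0|x0] := leP 0 x.
  rewrite truncn_ge_nat ?(le_trans x0 xy)//; apply: le_trans xy.
  by rewrite truncn_le.
by rewrite truncn_floor leNgt x0.
Qed.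

Section FiniteValued.
Context {d} {T : measurableType d} {A : finType}.
Implicit Types B : T -> A.

(** Measurability for the discrete sigma-algebra on [A], expressed by fibres so that [A] can stay a
    bare [finType]. *)
Definition fin_measurable B := forall a, measurable (B @^-1` [set a]).

Lemma fin_measurable_cst a : fin_measurable (fun=> a).
Proof.
move=> b; have [->|ab] := eqVneq a b.
  by rewrite (_ : _ @^-1` _ = setT)//; apply/seteqP; split.
rewrite (_ : _ @^-1` _ = set0)//; apply/seteqP; split => // w /= e.
by move: ab; rewrite e eqxx.
Qed.

Lemma fin_measurable_bind B (C : A -> T -> A) :
  fin_measurable B -> (forall a, fin_measurable (C a)) ->
  fin_measurable (fun w => C (B w) w).
Proof.
move=> mB mC a.
rewrite (_ : _ @^-1` _ = \bigcup_(b in [set: A]) (B @^-1` [set b] `&` C b @^-1` [set a])).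
  apply: fin_bigcup_measurable; first exact: finite_finset.
  by move=> b _; apply: measurableI; [exact: mB|exact: mC].
by apply/seteqP; split => [w Cw|w [b _ [/= <-]]//]; exists (B w).
Qed.

Context {R : realType}.

Lemma fin_measurable_if (f g : T -> R) (a b : A) :
  measurable_fun setT f -> measurable_fun setT g ->
  fin_measurable (fun w => if f w < g w then a else b).
Proof.
move=> mf mg c.
have mP : measurable [set w | f w < g w].
  have := measurable_fun_ltr mf mg measurableT (Y := [set true]).
  by rewrite setTI; apply.
rewrite (_ : _ @^-1` _ = ([set w | f w < g w] `&` (fun=> a) @^-1` [set c]) `|`
   (~` [set w | f w < g w] `&` (fun=> b) @^-1` [set c])).
  by apply: measurableU; apply: measurableI => //;
    [exact: fin_measurable_cst|exact: measurableC|exact: fin_measurable_cst].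
apply/seteqP; split => w /=; case: ifPn => fg.
- by left.
- by right; split => //; exact/negP.
- by case=> [[]//|[/(_ isT)]].
- by case=> [[]//|[]].
Qed.

Lemma measurable_fun_fin_case B (h : A -> T -> R) :
  fin_measurable B -> (forall a, measurable_fun setT (h a)) ->
  measurable_fun setT (fun w => h (B w) w).
Proof.
move=> mB mh.
rewrite (_ : (fun w => _) =
    fun w => \sum_(a <- enum A) (\1_(B @^-1` [set a]) : T -> R) w * h a w).
  apply: measurable_sum => a; apply: measurable_funM => //.
apply/funext => w; rewrite big_enum/= (bigD1 (B w))//= big1 ?addr0 => [|a aB].
  by rewrite indicE mem_set// mul1r.
rewrite indicE memNset ?mul0r//= => e; by rewrite e eqxx in aB.
Qed.

End FiniteValued.

Section HistMeasurable.
Context (R : realType) (K N : nat) (Us : finType)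
  (S : 'I_N -> {ffun 'I_N -> 'I_K} -> 'M[R]_N -> Us) (H : 'M[R]_N)
  (Y : {ffun 'I_N -> 'I_K} -> 'I_N -> R).
Local Notation arm := {ffun 'I_N -> Us}.
Context {d} {Omega : measurableType d}
  (eta : 'I_N -> nat -> Omega -> R) (unif : nat -> Omega -> R).

(** A list-valued map is tested through its additive functionals. Counts, reward sums and the
    exponents of the exponential weights all have this form. *)
Definition hist_measurable (h : Omega -> seq (arm * R)) :=
  forall g : arm * R -> R,
    (forall s, measurable_fun setT (fun x => g (s, x))) ->
    measurable_fun setT (fun w => \sum_(p <- h w) g p).

Lemma cntS_sum (h : seq (arm * R)) s :
  (cntS h s)%:R = \sum_(p <- h) (p.1 == s)%:R :> R.
Proof. by rewrite /cntS -sum1_count big_mkcond natr_sum; apply: eq_bigr => p _; case: eqP. Qed.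

Lemma hist_measurable_cnt h s (phi : nat -> R) : hist_measurable h ->
  measurable_fun setT (fun w => phi (cntS (h w) s)).
Proof.
move=> mh; apply: (measurable_fun_of_nat (m := fun w => cntS (h w) s)).
under eq_fun do rewrite cntS_sum.
by apply: (mh (fun p => (p.1 == s)%:R)) => s' /=; exact: measurable_cst.
Qed.

Lemma hist_measurable_Rhat h s : hist_measurable h ->
  measurable_fun setT (fun w => Rhat (h w) s).
Proof.
move=> mh; rewrite /Rhat; apply: measurable_funM; last first.
  exact: (hist_measurable_cnt s (fun m => m%:R^-1)).
under eq_fun do rewrite big_mkcond.
apply: (mh (fun p => if p.1 == s then p.2 else 0)) => s' /=.
by case: eqP => _; [exact: measurable_id|exact: measurable_cst].
Qed.

Lemma fin_measurable_argmax (f : Omega -> arm -> R) s0 l :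
  (forall s, measurable_fun setT (f ^~ s)) ->
  fin_measurable (fun w => argmax_seq (f w) s0 l).
Proof.
move=> mf; rewrite /argmax_seq.
(* The running best arm is itself random, so the induction needs an arbitrary measurable
   accumulator. *)
suff gen l' B : fin_measurable B -> fin_measurable (fun w =>
    foldl (fun best s => if f w best < f w s then s else best) (B w) l').
  exact/gen/fin_measurable_cst.
elim: l' B => [//|s l' IH] B mB /=.
apply: (IH (fun w => if f w (B w) < f w s then s else B w)).
apply: (fin_measurable_bind (C := fun b w => if f w b < f w s then s else b)) => // b.
exact: fin_measurable_if.
Qed.

Lemma fin_measurable_choice T1 delta s0 ord t h : hist_measurable h ->
  fin_measurable (fun w => ucb_choice T1 delta s0 ord t (h w)).
Proof.
move=> mh; rewrite /ucb_choice; case: leqP => _; first exact: fin_measurable_cst.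
apply: fin_measurable_argmax => s; apply: measurable_funD.
  exact: hist_measurable_Rhat.
exact: (hist_measurable_cnt s (fun m => Num.sqrt (9 * ln delta^-1 / m%:R))).
Qed.

Lemma measurable_round_reward s t :
  (forall i, measurable_fun setT (eta i t)) -> measurable_fun setT (unif t) ->
  measurable_fun setT (fun w => round_reward S H Y (fun i => eta i t w) s (unif t w)).
Proof.
move=> me mu; rewrite /round_reward /draw; case: (Defs.preim S H s) => [|a l] //.
apply: measurable_funM; first exact: measurable_cst.
rewrite [X in measurable_fun _ X](_ : _ = fun w =>
   \sum_(i <- enum 'I_N) (Y (nth a (a :: l) (Num.truncn (unif t w * (size (a :: l))%:R))) i
     + eta i t w)); last by apply/funext => w; rewrite big_enum.
apply: measurable_sum => i; apply: measurable_funD => //.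
apply: (measurable_fun_of_nat (fun k => Y (nth a (a :: l) k) i)).
apply: (measurableT_comp (@measurable_fun_truncn R)).
by apply: measurable_funM => //; exact: measurable_cst.
Qed.

(** Only the noise of rounds 1 to [t] is assumed measurable, so the lemma also applies when [Omega]
    carries the sigma-algebra of the past. *)
Lemma hist_measurable_ucb T1 delta s0 ord t :
  (forall i r, (0 < r <= t)%N -> measurable_fun setT (eta i r)) ->
  (forall r, (0 < r <= t)%N -> measurable_fun setT (unif r)) ->
  hist_measurable (ucb_hist S H Y eta unif T1 delta s0 ord t).
Proof.
elim: t => [|t IH] me mu g mg /=.
  by under eq_fun do rewrite big_nil; exact: measurable_cst.
have mh : hist_measurable (ucb_hist S H Y eta unif T1 delta s0 ord t).
  by apply: IH => [i r|r] /andP[r0 rt]; [apply: me|apply: mu]; rewrite r0 leqW.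
under eq_fun do rewrite big_rcons /=.
apply: measurable_funD; first exact: mh.
apply: (measurable_fun_fin_case (h := fun s w =>
  g (s, round_reward S H Y (fun i => eta i t.+1 w) s (unif t.+1 w)))).
  exact: fin_measurable_choice.
move=> s; apply: (measurableT_comp (mg s)).
by apply: measurable_round_reward => [i|]; [apply: me|apply: mu]; rewrite ltnS leqnn.
Qed.

End HistMeasurable.


(** * Moment generating function of a uniformly drawn bounded reward *)

Lemma expR_le_quadratic {R : realType} (z : R) : z <= 1 ->
  expR z <= 1 + z + 4 * z ^+ 2.
Proof.
move=> z1; have h0 : 0 < 1 - z / 2 by lra.
have h1 : 1 - z / 2 <= expR (- (z / 2)) by rewrite (le_trans _ (expR_ge1Dx _)).
have h2 : expR z * (1 - z / 2) ^+ 2 <= 1.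
  have -> : expR z = expR (- (z / 2)) ^- 2.
    by rewrite -expRM_natl -expRN; congr (expR _); field.
  rewrite mulrC ler_pdivrMr ?mul1r ?exprn_gt0 ?expR_gt0//.
  by rewrite ler_sqr ?nnegrE ?expR_ge0// ltW.
rewrite -(ler_pM2r (exprn_gt0 2 h0)) (le_trans h2)//.
(* This is [(1 + z + 4 z^2) (1 - z/2)^2 - 1]; the quadratic factor is positive for [z <= 1]. *)
have : 0 <= z ^+ 2 * (13 / 4 - 15 / 4 * z + z ^+ 2) by rewrite mulr_ge0 ?sqr_ge0//; nra.
lra.
Qed.

(** For [|lam| > 1] each exponent is at most [|lam| <= lam^2]. Otherwise the quadratic bound
    applies, and [y^2 <= y] makes it affine in [y], so that the sum depends on [mu] alone; the
    variance bound [mu - mu^2 <= 1/4] absorbs the factor 4. *)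
Lemma sum_expR_centered_le {R : realType} {A : Type} (l : seq A) (y : A -> R) (mu lam : R) :
  (forall a, 0 <= y a <= 1) -> \sum_(a <- l) y a = (size l)%:R * mu ->
  \sum_(a <- l) expR (lam * (y a - mu)) <= (size l)%:R * expR (lam ^+ 2).
Proof.
move=> y01 smu; have [/size0nil->|l0] := eqVneq (size l) 0%N.
  by rewrite big_nil mul0r.
have L0 : 0 < (size l)%:R :> R by rewrite ltr0n lt0n.
have sl (c : R) : \sum_(a <- l) c = (size l)%:R * c.
  by rewrite big_const_seq count_predT iter_addr_0 mulr_natl.
have mu01 : 0 <= mu <= 1.
  rewrite -(pmulr_rge0 _ L0) -(ler_pM2l L0 mu) -smu -sl.
  by rewrite sumr_ge0 ?ler_sum// => a _; case/andP: (y01 a).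
have [lam1|lam1] := leP `|lam| 1; last first.
  rewrite -sl; apply: ler_sum => a _; rewrite ler_expR.
  apply: (@le_trans _ _ `|lam|); last by rewrite -real_normK ?num_real// expr2 ler_peMl// ltW.
  rewrite (le_trans (ler_norm _))// normrM ler_piMr//.
  by have := y01 a; rewrite ler_norml; lra.
apply: (@le_trans _ _ (\sum_(a <- l) (1 - lam * mu - 0 + 4 * lam ^+ 2 * mu ^+ 2
   + (lam + 4 * lam ^+ 2 - 8 * lam ^+ 2 * mu) * y a))).
  apply: ler_sum => a _; have /andP[y0 y1] := y01 a.
  apply: le_trans (expR_le_quadratic _) _.
    rewrite (le_trans (ler_norm _))// normrM (le_trans _ lam1)// ler_piMr//.
    by rewrite ler_norml; lra.
  have : 0 <= lam ^+ 2 * (y a - y a ^+ 2).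
    by rewrite mulr_ge0 ?sqr_ge0//; nra.
  lra.
rewrite big_split/= sl -mulr_sumr smu.
have -> : (size l)%:R * (1 - lam * mu - 0 + 4 * lam ^+ 2 * mu ^+ 2) +
   (lam + 4 * lam ^+ 2 - 8 * lam ^+ 2 * mu) * ((size l)%:R * mu) =
   (size l)%:R * (1 + lam ^+ 2 * (4 * (mu - mu ^+ 2))) by ring.
rewrite ler_wpM2l//; apply: le_trans (expR_ge1Dx _).
by rewrite lerD2l ler_piMr ?sqr_ge0//; have := sqr_ge0 (2 * mu - 1); lra.
Qed.

Section UniformDraw.
Context {d} {Omega : measurableType d} {R : realType} (P : probability Omega R).

(** The truncation takes each value below [L] with probability [1/L] and larger values with
    probability 0. The condition on [F] beyond [L] matches [draw], where an index past the end
    returns the head of the list. *)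
Lemma integral_truncn_uniform (U : Omega -> R) (L : nat) (F : nat -> R) :
  uniform01 P U -> (0 < L)%N -> (forall k, 0 <= F k) ->
  (forall k, (L <= k)%N -> F k = F 0%N) ->
  (\int[P]_w (F (Num.truncn (U w * L%:R)))%:E <= ((\sum_(k < L) F k) / L%:R)%:E)%E.
Proof.
move=> [mU uU] L0 F0 FL.
have LR : 0 < L%:R :> R by rewrite ltr0n.
pose m w := Num.truncn (U w * L%:R).
have mm (phi : nat -> R) : measurable_fun setT (fun w => phi (m w)).
  apply: measurable_fun_of_nat; apply: (measurableT_comp (@measurable_fun_truncn R)).
  by apply: measurable_funM => //; exact: measurable_cst.
have mS (B : set nat) : measurable [set w | B (m w)].
  have := mm (fun k => (k \in B)%:R) measurableT [set 1] (measurable_set1 _).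
  rewrite setTI; congr measurable; apply/seteqP; split => w /=.
    by case: (boolP (m w \in B)) => [/set_mem//|_ /eqP]; rewrite eq_sym oner_eq0.
  by move=> /mem_set ->.
have Ple k : (k < L)%N -> P [set w | (m w <= k)%N] = (k.+1%:R / L%:R)%:E.
  move=> kL; rewrite -uU; last first.
    by rewrite divr_ge0//= ler_pdivrMr// mul1r ler_nat.
  congr (P _); apply/seteqP; split => w /=; rewrite /m truncn_le_nat ltr_pdivlMr//.
have Peq k : (k < L)%N -> P [set w | m w = k] = (L%:R^-1)%:E.
  case: k => [|k] kL.
    rewrite -[L%:R^-1]mul1r -(Ple 0%N)//; congr (P _); apply/seteqP; split => w /=; lia.
  have -> : [set w | m w = k.+1] = [set w | (m w <= k.+1)%N] `\` [set w | (m w <= k)%N].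
    by apply/seteqP; split => w /=; lia.
  rewrite measureD//; last 3 first.
  - exact: mS (fun j => (j <= k.+1)%N).
  - exact: mS (fun j => (j <= k)%N).
  - by rewrite ltey_eq fin_num_measure//; exact: mS (fun j => (j <= k.+1)%N).
  rewrite setIidr; last by move=> w /=; lia.
  transitivity ((k.+2%:R / L%:R)%:E - (k.+1%:R / L%:R)%:E : \bar R)%E.
    by congr (_ - _)%E; apply: Ple; lia.
  by rewrite -EFinB -mulrBl -natrB// subSnn mul1r.
have PL : P [set w | (L <= m w)%N] = 0%E.
  have -> : [set w | (L <= m w)%N] = ~` [set w | (m w <= L.-1)%N].
    by apply/seteqP; split => w /=; lia.
  rewrite probability_setC; last exact: mS (fun j => (j <= L.-1)%N).
  by rewrite Ple prednK// divff ?subee// lt0r_neq0.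
have mI B : measurable_fun setT (fun w => (\1_[set w | B (m w)] w)%:E : \bar R).
  by apply/measurable_EFinP/measurable_indic; exact: mS.
(* The integrand is split according to the value of the index; the null event of an index at least
   [L] goes to [tail]. *)
pose term k w : \bar R := ((F k)%:E * (\1_[set w | m w = k] w)%:E)%E.
pose tail w : \bar R := ((F 0%N)%:E * (\1_[set w | (L <= m w)%N] w)%:E)%E.
have mterm k : measurable_fun setT (term k).
  by apply: measurable_funeM; exact: (mI (fun j => j = k)).
have mtail : measurable_fun setT tail.
  by apply: measurable_funeM; exact: (mI (fun j => (L <= j)%N)).
have term0 k w : (0 <= term k w)%E by rewrite mule_ge0 ?lee_fin.
have tail0 w : (0 <= tail w)%E by rewrite mule_ge0 ?lee_fin.
apply: (@le_trans _ _ (\int[P]_w (\sum_(k < L) term k w + tail w))%E).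
  apply: ge0_le_integral => //.
  - by move=> w _; rewrite lee_fin.
  - exact/measurable_EFinP/mm.
  - by apply: emeasurable_funD => //; exact: emeasurable_sum.
  - move=> w _; have [mL|Lm] := ltnP (m w) L.
      rewrite (bigD1 (Ordinal mL))//= {1}/term indicE mem_set// mule1.
      by rewrite -addeA leeDl// adde_ge0// sume_ge0.
    by rewrite /tail indicE mem_set// mule1 (FL (m w) Lm) leeDr// sume_ge0.
rewrite ge0_integralD//; last 2 first.
- by move=> w _; rewrite sume_ge0.
- exact: emeasurable_sum.
rewrite ge0_integral_sum//.
rewrite [X in (_ + X)%E](_ : _ = 0)%E ?adde0; last first.
  rewrite ge0_integralZl_EFin//; last exact: (mI (fun j => (L <= j)%N)).
  rewrite integral_indic//; last exact: (mS (fun j => (L <= j)%N)).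
  by rewrite setIT [X in (_ * X)%E]PL mule0.
rewrite mulr_suml -sumEFin lee_sum// => k _.
rewrite ge0_integralZl_EFin//; last exact: (mI (fun j => j = k)).
rewrite integral_indic//; last exact: (mS (fun j => j = k)).
by rewrite setIT [X in (_ * X)%E]Peq.
Qed.

End UniformDraw.


(** * The noise filtration and the exponential supermartingale *)

Section Filtration.
Variable N : nat.

Definition round_of (j : ('I_N * nat) + nat) : nat :=
  match j with inl p => p.2 | inr t => t end.

Definition fresh t : seq (('I_N * nat) + nat) :=
  inr t :: [seq inl (i, t) | i <- enum 'I_N].

(** Rounds are numbered from 1, so these are the variables of rounds 1 to [t], on which the history
    of length [t] depends. *)
Fixpoint past t : seq (('I_N * nat) + nat) :=
  if t is t'.+1 then fresh t ++ past t' else [::].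

Lemma mem_fresh t j :
  (j \in fresh t) = (round_of j == t).
Proof.
rewrite inE; case: j => [[i r]|r] /=.
  apply/mapP/eqP => [[k _ [_ ->]]//|->]; by exists i => //; rewrite mem_enum.
rewrite orbC; case: mapP => [[//]|_]; by [].
Qed.

Lemma mem_past t j :
  (j \in past t) = (0 < round_of j <= t)%N.
Proof.
elim: t => [|t IH]; first by rewrite /= in_nil; lia.
by rewrite -[past t.+1]/(fresh t.+1 ++ past t) mem_cat mem_fresh IH; lia.
Qed.

Lemma uniq_past t : uniq (past t).
Proof.
elim: t => // t IH; rewrite -[past t.+1]/(fresh t.+1 ++ past t) cat_uniq IH andbT.
apply/andP; split.
  rewrite /= map_inj_uniq ?enum_uniq ?andbT; last by move=> i k [].
  by apply/mapP => -[].
by apply/hasPn => j; rewrite mem_past mem_fresh; lia.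
Qed.

End Filtration.

Section Supermartingale.
Context (R : realType) (K N : nat) (Us : finType)
  (S : 'I_N -> {ffun 'I_N -> 'I_K} -> 'M[R]_N -> Us) (H : 'M[R]_N)
  (Y : {ffun 'I_N -> 'I_K} -> 'I_N -> R).
Local Notation arm := {ffun 'I_N -> Us}.
Hypothesis Y01 : forall A i, 0 <= Y A i <= 1.
Hypothesis N0 : (0 < N)%N.
Context {d} {Omega : measurableType d} (P : probability Omega R)
  (eta : 'I_N -> nat -> Omega -> R) (unif : nat -> Omega -> R).
Hypothesis sub_eta : forall i t, subgaussian1 P (eta i t).
Hypothesis unif_unif : forall t, uniform01 P (unif t).
Let noise (j : ('I_N * nat) + nat) :=
  match j with inl p => eta p.1 p.2 | inr t => unif t end.
Hypothesis indep : mutually_independent P noise.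

Local Notation mu := (meanY S H Y).
Local Notation reward t s w := (round_reward S H Y (fun i => eta i t w) s (unif t w)).

Let Ybar A := N%:R^-1 * \sum_(i < N) Y A i.

Lemma sum_Ybar s : \sum_(A <- Defs.preim S H s) Ybar A = (size (Defs.preim S H s))%:R * mu s.
Proof.
have [/size0nil ->|s0] := eqVneq (size (Defs.preim S H s)) 0%N.
  by rewrite big_nil mul0r.
rewrite /meanY /Ytil /Ybar -mulr_sumr exchange_big/= -mulr_suml mulrCA.
by congr (_ * _); rewrite mulrCA divff ?mulr1// pnatr_eq0.
Qed.

Lemma Ybar01 A : 0 <= Ybar A <= 1.
Proof.
have NR : 0 < N%:R :> R by rewrite ltr0n.
rewrite mulr_ge0 ?invr_ge0 ?sumr_ge0//= => [|i _]; last by case/andP: (Y01 A i).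
rewrite /Ybar mulrC ler_pdivrMr// mul1r.
rewrite -[in leRHS](card_ord N) -sum1_card natr_sum ler_sum// => i _.
by case/andP: (Y01 A i).
Qed.

Lemma measurable_noise j : measurable_fun setT (noise j).
Proof. by case: j => [[i t]|t]; [have [] := sub_eta i t|have [] := unif_unif t]. Qed.

(** The supermartingale step for a fixed arm: [f] depends on the past only, and the exponential is a
    product of functions of fresh variables, one for the draw and one for each unit noise. *)
Lemma expR_reward_le t s lam (f : Omega -> R) :
  (0 < size (Defs.preim S H s))%N ->
  measurable_fun (setT : set (g_sigma_algebraType (cylinders noise (past N t)))) f ->
  (forall w, 0 <= f w) ->
  (\int[P]_w (f w * expR (lam * (reward t.+1 s w - mu s) - 3 / 2 * lam ^+ 2))%:E
     <= \int[P]_w (f w)%:E)%E.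
Proof.
move=> s0 mf f0; set l := Defs.preim S H s in s0 *.
have [a [l' El]] : exists a l', l = a :: l' by case: (l) s0 => // a l' _; exists a, l'.
have NR : 0 < N%:R :> R by rewrite ltr0n.
pose F k := expR (lam * (Ybar (nth a l k) - mu s)).
pose phi (j : ('I_N * nat) + nat) (x : R) : R :=
  match j with inl _ => expR (lam / N%:R * x)
             | inr _ => F (Num.truncn (x * (size l)%:R)) end.
(* The draw contributes [exp(lam^2)], and each unit noise enters the average with coefficient
   [lam / N]. *)
pose c (j : ('I_N * nat) + nat) : R :=
  match j with inl _ => expR ((lam / N%:R) ^+ 2 / 2) | inr _ => expR (lam ^+ 2) end.
have mphi j : measurable_fun setT (phi j).
  move: j; case=> [p|r] /=.
    by apply: measurableT_comp => //; apply: measurable_funM => //; exact: measurable_cst.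
  apply: (measurable_fun_of_nat F); apply: (measurableT_comp (@measurable_fun_truncn R)).
  by apply: measurable_funM => //; exact: measurable_cst.
have phi0 j x : 0 <= phi j x by case: j => *; exact: expR_ge0.
have rewardE w : expR (lam * (reward t.+1 s w - mu s) - 3 / 2 * lam ^+ 2) =
    \prod_(j <- fresh N t.+1) phi j (noise j w) * expR (- (3 / 2 * lam ^+ 2)).
  rewrite big_cons big_map /= big_enum/= expRD; congr (_ * _).
  rewrite -expR_sum /F -expRD; congr (expR _).
  rewrite /round_reward /draw -/l El -El big_split/=.
  by rewrite -mulr_sumr /Ybar; ring.
under eq_integral do rewrite rewardE mulrA EFinM.
rewrite ge0_integralZr//=; last 2 first.
- apply/measurable_EFinP; apply: measurable_funM.
    exact: (measurable_fun_cylinders measurable_noise mf).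
  apply: measurable_prod => j _.
  by apply: measurableT_comp => //; exact: measurable_noise.
- by move=> w _; rewrite lee_fin mulr_ge0 ?prodr_ge0.
have h := @integral_fresh_le _ _ _ P _ noise measurable_noise indep (past N t) (fresh N t.+1) f phi c.
apply: (@le_trans _ _ ((\prod_(j <- fresh N t.+1) c j)%:E * 
  \int[P]_w (f w)%:E * (expR (- (3 / 2 * lam ^+ 2)))%:E)%E).
  apply: lee_wpmul2r; first by rewrite lee_fin expR_ge0.
  apply: h => //.
  - exact: (uniq_past N t.+1).
  - by case=> *; exact: expR_ge0.
  - case=> [[i r]|r] _ /=; first by have [_ [_]] := sub_eta i r; apply.
    apply: le_trans (integral_truncn_uniform (unif_unif r) s0 _ _) _.
    + by move=> k; exact: expR_ge0.
    + by move=> k lk; rewrite /F nth_default// El.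
    rewrite lee_fin ler_pdivrMr ?ltr0n// mulrC.
    have := @sum_expR_centered_le R _ l Ybar (mu s) lam Ybar01 (sum_Ybar s).
    by rewrite (big_nth a) big_mkord.
rewrite muleAC -EFinM -[leRHS]mul1e lee_wpmul2r//.
  by apply: integral_ge0 => w _; rewrite lee_fin.
rewrite lee_fin big_cons big_map /= big_enum/= prodr_const card_ord.
rewrite -expRM_natl -!expRD -[leRHS]expR0 ler_expR.
(* The [N] noises together cost [lam^2 / (2 N)]; with the [lam^2] of the draw this stays within the
   compensator [3/2 lam^2]. *)
have : N%:R * ((lam / N%:R) ^+ 2 / 2) <= lam ^+ 2 / 2.
  rewrite (_ : _ * _ = lam ^+ 2 / 2 * N%:R^-1); last by field; rewrite lt0r_neq0.
  by rewrite ler_piMr ?divr_ge0 ?sqr_ge0// invf_le1// ler1n.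
lra.
Qed.

(** The supermartingale as a function of the history, so that it can be used in pathwise
    inequalities before any integration. *)
Definition expweight (lam : arm -> R) (h : seq (arm * R)) : R :=
  expR (\sum_(p <- h) (lam p.1 * (p.2 - mu p.1) - 3 / 2 * lam p.1 ^+ 2)).

Lemma measurable_expweight {d'} {T : measurableType d'} (h : T -> seq (arm * R)) lam :
  hist_measurable h -> measurable_fun setT (fun w => expweight lam (h w)).
Proof.
move=> mh; apply: measurableT_comp => //.
apply: (mh (fun p => lam p.1 * (p.2 - mu p.1) - 3 / 2 * lam p.1 ^+ 2)) => s /=.
apply: measurable_funB => //; apply: measurable_funM => //.
exact: measurable_funB.
Qed.

Lemma argmax_seq_in (f : arm -> R) s0 l : l != [::] -> argmax_seq f s0 l \in l.
Proof.
case: l => // a l _; rewrite /argmax_seq /=.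
elim: l a => [|b l IH] a /=; first exact: mem_head.
case: ifP => _; first by rewrite in_cons IH orbT.
by have := IH a; rewrite !in_cons => /orP[->//|->]; rewrite !orbT.
Qed.

Context (T1 : nat) (delta : R) (s0 : arm) (ord : seq arm).
Hypotheses (ord0 : ord != [::]) (uord : uniq ord)
  (ordP : forall s, s \in ord -> (0 < size (Defs.preim S H s))%N).

Local Notation hist := (ucb_hist S H Y eta unif T1 delta s0 ord).

Lemma ucb_choice_in t h : ucb_choice T1 delta s0 ord t h \in ord.
Proof.
rewrite /ucb_choice; case: ifP => _; last exact: argmax_seq_in.
by rewrite mem_nth// ltn_mod lt0n size_eq0.
Qed.

Lemma hist_measurable_past t :
  hist_measurable (hist t : g_sigma_algebraType (cylinders noise (past N t)) -> _).
Proof.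
apply: hist_measurable_ucb => [i r|r] rt.
  by apply: (@measurable_cylinder_coord _ _ _ _ noise (past N t) (inl (i, r))); rewrite mem_past.
by apply: (@measurable_cylinder_coord _ _ _ _ noise (past N t) (inr r)); rewrite mem_past.
Qed.

Lemma hist_measurableT t : hist_measurable (hist t).
Proof.
apply: hist_measurable_ucb => [i r|r] _; first exact: (measurable_noise (inl (i, r))).
exact: (measurable_noise (inr r)).
Qed.

Lemma expweight_ge0 lam h : 0 <= expweight lam h.
Proof. exact: expR_ge0. Qed.

(** Induction on [t]. The choice in round [t + 1] is determined by the past, so its indicator joins
    the past factor; on each such event the arm is fixed and the one-step bound applies. *)
Lemma integral_expweight_le1 lam t :
  (\int[P]_w (expweight lam (hist t w))%:E <= 1)%E.
Proof.
elim: t => [|t IH].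
  rewrite /expweight; under eq_integral do rewrite big_nil expR0.
  by rewrite integral_cst// mul1e; exact: probability_le1.
pose choice w := ucb_choice T1 delta s0 ord t.+1 (hist t w).
pose f s w := \1_(choice @^-1` [set s]) w * expweight lam (hist t w).
pose g s w := expR (lam s * (reward t.+1 s w - mu s) - 3 / 2 * lam s ^+ 2).
have f0 s w : 0 <= f s w by rewrite mulr_ge0// expweight_ge0.
have mf s : measurable_fun (setT : set (g_sigma_algebraType (cylinders noise (past N t)))) (f s).
  apply: measurable_funM.
    have mc : fin_measurable (choice : g_sigma_algebraType (cylinders noise (past N t)) -> _).
      by apply: fin_measurable_choice; exact: hist_measurable_past.
    by apply: measurable_indic; exact: mc.
  by apply: measurable_expweight; exact: hist_measurable_past.
have mg s : measurable_fun setT (g s).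
  apply: measurableT_comp => //; apply: measurable_funB => //; apply: measurable_funM => //.
  apply: measurable_funB => //; apply: measurable_round_reward => [i|].
    exact: (measurable_noise (inl (i, t.+1))).
  exact: (measurable_noise (inr t.+1)).
(* The choice lies in [ord], which has no duplicates, so exactly one indicator is nonzero. *)
have sumE (k : arm -> R) w :
    \sum_(s <- ord) \1_(choice @^-1` [set s]) w * k s = k (choice w).
  rewrite (bigD1_seq (choice w)) ?ucb_choice_in//= big1 ?addr0 => [|s sc].
    by rewrite indicE mem_set// mul1r.
  rewrite indicE memNset ?mul0r//= => e; by rewrite e eqxx in sc.
have -> : (\int[P]_w (expweight lam (hist t.+1 w))%:E =
    \int[P]_w \sum_(s <- ord) (f s w * g s w)%:E)%E.
  apply: eq_integral => w _; rewrite sumEFin; congr EFin.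
  under eq_bigr do rewrite -mulrA.
  rewrite (sumE (fun s => expweight lam (hist t w) * g s w)).
  by rewrite /expweight /= big_rcons /= expRD mulrC.
have mfg s : measurable_fun setT (fun w => (f s w * g s w)%:E).
  apply/measurable_EFinP; apply: measurable_funM => //.
  exact: (measurable_fun_cylinders measurable_noise (mf s)).
rewrite ge0_integral_sum//; last by move=> s w _; rewrite lee_fin mulr_ge0// expR_ge0.
apply: (@le_trans _ _ (\sum_(s <- ord) \int[P]_w (f s w)%:E)%E).
  rewrite !big_seq lee_sum// => s sord.
  by apply: expR_reward_le => //; exact: ordP.
rewrite -ge0_integral_sum//; last 2 first.
- move=> s; apply/measurable_EFinP; exact: (measurable_fun_cylinders measurable_noise (mf s)).
- by move=> s w _; rewrite lee_fin.
apply: le_trans IH; rewrite le_eqVlt; apply/orP; left; apply/eqP.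
apply: eq_integral => w _; rewrite sumEFin; congr EFin.
by rewrite (sumE (fun s => expweight lam (hist t w))).
Qed.

End Supermartingale.


(** * Deterministic analysis of one sample path *)

Lemma leq_divn_count_modn n t k : (k < n)%N ->
  (t %/ n <= count (fun r => r %% n == k) (iota 0 t))%N.
Proof.
move=> kn; have n0 : (0 < n)%N by lia.
suff h q : (q * n <= t)%N -> (q <= count (fun r => r %% n == k) (iota 0 t))%N.
  exact/h/leq_divM.
elim: q t => // q IH t qt.
(* The first [q] blocks are handled by induction; the remainder has length at least [n] and contains
   the round [q * n + k]. *)
have -> : t = (q * n + (t - q * n))%N by lia.
rewrite iotaD count_cat add0n -addn1 leq_add//; first exact: IH.
rewrite -has_count; apply/hasP; exists (q * n + k)%N; last by rewrite modnMDl modn_small.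
by rewrite mem_iota; lia.
Qed.

Lemma sum_sqrt_le {R : rcfType} {A : Type} (l : seq A) (m : A -> nat) (t : nat) :
  (\sum_(a <- l) m a = t)%N ->
  \sum_(a <- l) Num.sqrt (m a)%:R <= Num.sqrt ((size l)%:R * t%:R) :> R.
Proof.
move=> mt; have [l0|l0] := eqVneq (size l) 0%N.
  by rewrite (size0nil l0) big_nil sqrtr_ge0.
have [t0|t0] := eqVneq t 0%N.
  suff -> : \sum_(a <- l) Num.sqrt (m a)%:R = 0 :> R by rewrite sqrtr_ge0.
  have {t0}mt : (\sum_(a <- l) m a = 0)%N by rewrite mt t0.
  elim: l mt {l0} => [|a l IH]; first by rewrite !big_nil.
  by rewrite !big_cons => /eqP; rewrite addn_eq0 => /andP[/eqP -> /eqP/IH ->]; rewrite sqrtr0 addr0.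
have L0 : 0 < Num.sqrt (size l)%:R :> R by rewrite sqrtr_gt0 ltr0n lt0n.
have T0 : 0 < Num.sqrt t%:R :> R by rewrite sqrtr_gt0 ltr0n lt0n.
have L2 : Num.sqrt (size l)%:R ^+ 2 = (size l)%:R :> R by rewrite sqr_sqrtr.
have T2 : Num.sqrt t%:R ^+ 2 = t%:R :> R by rewrite sqr_sqrtr.
rewrite sqrtrM//; move: L0 T0 L2 T2.
set x := Num.sqrt (size l)%:R; set y := Num.sqrt t%:R => x0 y0 x2 y2.
(* AM-GM: [2 sqrt m <= m x / y + y / x] *)
apply: (@le_trans _ _ (\sum_(a <- l) ((m a)%:R * (x / y / 2) + y / x / 2))).
  apply: ler_sum => a _; set z := Num.sqrt _.
  have -> : (m a)%:R = z ^+ 2 by rewrite sqr_sqrtr.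
  rewrite -subr_ge0 (_ : _ - z = (z * x - y) ^+ 2 / (2 * x * y)).
    by rewrite divr_ge0 ?sqr_ge0// !mulr_ge0// ltW.
  by field; rewrite !lt0r_neq0.
rewrite big_split/= -mulr_suml -natr_sum mt big_const_seq count_predT iter_addr_0.
rewrite -[_ *+ size l]mulr_natl -x2 -y2 le_eqVlt; apply/orP; left; apply/eqP.
by field; rewrite !lt0r_neq0.
Qed.

(** The increment is [1 / (sqrt(m + 1) + sqrt m)] and [sqrt(m + 1) <= 2 sqrt m]. This lets the
    bonuses of successive pulls telescope. *)
Lemma invsqrt_le {R : rcfType} (m : nat) : (0 < m)%N ->
  (Num.sqrt m%:R)^-1 <= 3 * (Num.sqrt m.+1%:R - Num.sqrt m%:R) :> R.
Proof.
move=> m0; have x1 : 1 <= Num.sqrt m%:R :> R by rewrite -[leLHS]sqrtr1 ler_sqrt// ler1n.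
have x2 : Num.sqrt m%:R ^+ 2 = m%:R :> R by rewrite sqr_sqrtr.
have y2 : Num.sqrt m.+1%:R ^+ 2 = m%:R + 1 :> R by rewrite sqr_sqrtr// -natr1.
have y0 : 0 <= Num.sqrt m.+1%:R :> R by exact: sqrtr_ge0.
move: x1 x2 y2 y0; set x := Num.sqrt m%:R; set y := Num.sqrt m.+1%:R => x1 x2 y2 y0.
have x0 : 0 < x by lra.
rewrite -(ler_pM2l x0) divff ?lt0r_neq0//.
have yx : y <= 2 * x by rewrite -ler_sqr ?nnegrE ?exprMn ?mulr_ge0 ?(ltW x0)// y2 -x2; nra.
have xy : x <= y by rewrite -ler_sqr ?nnegrE ?(ltW x0)// y2 -x2; lra.
nra.
Qed.

Section Run.
Context (R : realType) (K N : nat) (Us : finType)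
  (S : 'I_N -> {ffun 'I_N -> 'I_K} -> 'M[R]_N -> Us) (H : 'M[R]_N)
  (Y : {ffun 'I_N -> 'I_K} -> 'I_N -> R).
Local Notation arm := {ffun 'I_N -> Us}.
Local Notation mu := (meanY S H Y).
Local Notation expweight := (expweight S H Y).

Lemma expweight_arm (s : arm) (l : R) (h : seq (arm * R)) :
  expweight (fun s' => if s' == s then l else 0) h =
  expR ((cntS h s)%:R * (l * (Rhat h s - mu s) - 3 / 2 * l ^+ 2)).
Proof.
congr expR.
transitivity (\sum_(p <- h | p.1 == s) (l * p.2 - (l * mu s + 3 / 2 * l ^+ 2))).
  rewrite [RHS]big_mkcond; apply: eq_bigr => p _ /=.
  by case: eqP => [->|_]; ring.
rewrite sumrB -mulr_sumr big_const_seq -/(cntS h s) iter_addr_0 -mulr_natl /Rhat.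
(* For an arm never pulled [Rhat] is a division by zero, but the factor [cntS] kills it and both
   exponents vanish. *)
have [c0|c0] := eqVneq (cntS h s) 0%N.
  have -> : \sum_(p <- h | p.1 == s) p.2 = 0.
    rewrite big_hasC// has_count -leqNgt; by rewrite /cntS in c0; rewrite c0.
  by rewrite c0; ring.
by field; rewrite pnatr_eq0.
Qed.

Lemma argmax_seq_max (f : arm -> R) s0 l s : s \in l -> f s <= f (argmax_seq f s0 l).
Proof.
case: l => // a l; rewrite /argmax_seq /=.
elim: l a s => [|b l IH] a s /=; first by rewrite inE => /eqP ->.
have h := IH (if f a < f b then b else a).
rewrite !inE => /or3P[/eqP->|/eqP->|sl].
- apply: le_trans (h _ (mem_head _ _)); by case: ltP => // /ltW.
- apply: le_trans (h _ (mem_head _ _)); by case: ltP.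
- by apply: h; rewrite inE sl orbT.
Qed.

Context (T T1 : nat) (s0 : arm) (ord : seq arm).
Hypotheses (T2 : (1 < T)%N) (T1T : (T1 <= T)%N) (uord : uniq ord) (nT1 : (size ord <= T1)%N)
  (ord0 : ord != [::]) (mu01 : forall s, 0 <= mu s <= 1).
Let delta : R := (T%:R ^+ 2)^-1.
Let bonus (m : nat) : R := Num.sqrt (9 * ln delta^-1 / m%:R).

(** A union bound written as a sum: both signs, all arms, and all values [m] of the random count.
    The slope [bonus m / 3] maximizes [lam * b - 3/2 lam^2] at [b = bonus m]. *)
Definition bad_weight (h : seq (arm * R)) : R :=
  \sum_(s <- ord) \sum_(m < T.+1)
    (expweight (fun s' => if s' == s then bonus m / 3 else 0) h +
     expweight (fun s' => if s' == s then - (bonus m / 3) else 0) h).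

Lemma bad_weight_ge0 h : 0 <= bad_weight h.
Proof. by rewrite sumr_ge0// => s _; rewrite sumr_ge0// => m _; rewrite addr_ge0// expR_ge0. Qed.

(** At slope [b / 3] a deviation of at least [b] gives exponent at least [m b^2 / 6], which is
    [3 ln T] because [m b^2 = 9 ln(T^2)]. *)
Lemma deviation_bad_weight h s : s \in ord -> (0 < cntS h s <= T)%N ->
  bonus (cntS h s) <= `|Rhat h s - mu s| -> T%:R ^+ 3 <= bad_weight h.
Proof.
move=> sord /andP[m0 mT] dev; set m := cntS h s in m0 mT dev *.
rewrite /bad_weight (bigD1_seq s)//= -[leLHS]addr0 lerD//; last first.
  by rewrite sumr_ge0// => ? _; rewrite sumr_ge0// => ? _; rewrite addr_ge0// expR_ge0.
have mT' : (m < T.+1)%N by [].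
rewrite (bigD1 (Ordinal mT'))//= -[leLHS]addr0 lerD//; last first.
  by rewrite sumr_ge0// => ? _; rewrite addr_ge0// expR_ge0.
have T0 : 0 < T%:R :> R by rewrite ltr0n; lia.
have lnT : 0 <= ln T%:R :> R by rewrite ln_ge0// ler1n; lia.
have b2 : m%:R * bonus m ^+ 2 = 18 * ln T%:R.
  rewrite sqr_sqrtr /delta invrK lnXn//.
    by rewrite -mulr_natr; field; rewrite pnatr_eq0; lia.
  by rewrite divr_ge0// mulr_ge0// mulrn_wge0.
have b0 : 0 <= bonus m by exact: sqrtr_ge0.
have -> : (T%:R : R) ^+ 3 = expR (3 * ln T%:R).
  by rewrite -[in LHS](@lnK R T%:R) ?posrE// -expRM_natl.
rewrite !expweight_arm -/m.
have [d0|d0] := leP 0 (Rhat h s - mu s).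
  rewrite -[leLHS]addr0 lerD ?expR_ge0// ler_expR.
  rewrite ger0_norm// in dev.
  have : 0 <= m%:R * (bonus m * (Rhat h s - mu s - bonus m)).
    by rewrite !mulr_ge0// subr_ge0.
  lra.
rewrite -[leLHS]add0r lerD ?expR_ge0// ler_expR.
rewrite ltr0_norm// in dev.
have : 0 <= m%:R * (bonus m * (- (Rhat h s - mu s) - bonus m)).
  by rewrite !mulr_ge0// subr_ge0.
lra.
Qed.

(** If one of the two arms deviates, the last term is at least 1 and exceeds any gap. Otherwise the
    usual optimism argument applies: [mu s] is below the index of [s], hence below that of the
    chosen arm, which exceeds its mean by at most two bonuses. *)
Lemma ucb_gap_le t h s : (T1 < t)%N -> s \in ord ->
  (forall s', s' \in ord -> (0 < cntS h s' <= T)%N) ->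
  mu s - mu (ucb_choice T1 delta s0 ord t h) <=
    2 * bonus (cntS h (ucb_choice T1 delta s0 ord t h)) + T%:R ^- 3 * bad_weight h.
Proof.
move=> T1t sord cnt; set s' := ucb_choice _ _ _ _ _ _.
have s'ord : s' \in ord by exact: ucb_choice_in.
have T0 : 0 < T%:R ^+ 3 :> R by rewrite exprn_gt0// ltr0n; lia.
have bad s1 : s1 \in ord -> bonus (cntS h s1) <= `|Rhat h s1 - mu s1| ->
    mu s - mu s' <= 2 * bonus (cntS h s') + T%:R ^- 3 * bad_weight h.
  move=> s1ord dev.
  have := deviation_bad_weight s1ord (cnt _ s1ord) dev.
  rewrite -[T%:R ^+ 3]mulr1 -ler_pdivlMl// => w1.
  have : 0 <= bonus (cntS h s') by exact: sqrtr_ge0.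
  have := mu01 s; have := mu01 s'; lra.
have [dev|dev] := leP (bonus (cntS h s)) `|Rhat h s - mu s|; first exact: bad dev.
have [dev'|dev'] := leP (bonus (cntS h s')) `|Rhat h s' - mu s'|; first exact: bad dev'.
have := argmax_seq_max (fun s => Rhat h s + Num.sqrt (9 * ln (delta^-1) / (cntS h s)%:R)) s0 sord.
have -> : argmax_seq (fun s => Rhat h s + Num.sqrt (9 * ln (delta^-1) / (cntS h s)%:R)) s0 ord = s'.
  by rewrite /s' /ucb_choice leqNgt T1t.
rewrite -/(bonus _) -/(bonus _) => ucb.
move: dev dev'; rewrite !ltr_norml => /andP[d1 d2] /andP[d3 d4].
have : 0 <= T%:R ^- 3 * bad_weight h by rewrite mulr_ge0 ?bad_weight_ge0// invr_ge0 ltW.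
lra.
Qed.

(** An abstract run with arbitrary recorded rewards, to be instantiated by the algorithm at each
    sample point. *)
Variable h : nat -> seq (arm * R).
Hypothesis h0 : h 0%N = [::].
Hypothesis hS : forall t, exists x,
  h t.+1 = rcons (h t) (ucb_choice T1 delta s0 ord t.+1 (h t), x).
Local Notation choice t := (ucb_choice T1 delta s0 ord t.+1 (h t)).

Lemma cntS_run t s : cntS (h t.+1) s = (cntS (h t) s + (choice t == s))%N.
Proof. by have [x ->] := hS t; rewrite /cntS -cats1 count_cat /= addn0. Qed.

Lemma cntS_round_robin t s : (t <= T1)%N ->
  cntS (h t) s = count (fun r => nth s0 ord (r %% size ord) == s) (iota 0 t).
Proof.
elim: t => [|t IH] tT1; first by rewrite h0.
rewrite cntS_run IH ?(ltnW tT1)// -[in RHS]addn1 iotaD count_cat /= addn0 add0n.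
by rewrite /ucb_choice tT1 subn1.
Qed.

Lemma leq_divn_cntS_round_robin s : s \in ord -> (T1 %/ size ord <= cntS (h T1) s)%N.
Proof.
move=> sord; rewrite cntS_round_robin//.
apply: leq_trans (leq_divn_count_modn T1 (_ : index s ord < size ord)%N) _.
  by rewrite index_mem.
by apply: sub_count => r /= /eqP ->; rewrite nth_index.
Qed.

Lemma leq_cntS_run t t' s : (t <= t')%N -> (cntS (h t) s <= cntS (h t') s)%N.
Proof.
move=> /subnK <-; elim: (t' - t)%N => // k IH.
by rewrite addSn cntS_run (leq_trans IH)// leq_addr.
Qed.

Lemma size_run t : size (h t) = t.
Proof. by elim: t => [|t IH]; [rewrite h0|have [x ->] := hS t; rewrite size_rcons IH]. Qed.

Lemma sum_cntS_run t : (\sum_(s <- ord) cntS (h t) s = t)%N.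
Proof.
elim: t => [|t IH]; first by rewrite h0 big1.
under eq_bigr do rewrite cntS_run.
rewrite big_split/= IH (bigD1_seq (choice t)) ?ucb_choice_in//= eqxx big1 ?addn0 ?addn1//.
by move=> s /negbTE; rewrite eq_sym => ->.
Qed.

Lemma cntS_run_bounds t s : (T1 <= t <= T)%N -> s \in ord -> (0 < cntS (h t) s <= T)%N.
Proof.
move=> /andP[T1t tT] sord; apply/andP; split.
  apply: (leq_trans _ (leq_cntS_run s T1t)); apply: leq_trans (leq_divn_cntS_round_robin sord).
  by rewrite divn_gt0// lt0n size_eq0.
by rewrite (leq_trans (count_size _ _))// size_run.
Qed.

Let c : R := Num.sqrt (18 * ln T%:R).

Lemma bonusE m : bonus m = c * (Num.sqrt m%:R)^-1.
Proof.
have lnT : 0 <= ln T%:R :> R by rewrite ln_ge0// ler1n; lia.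
rewrite /bonus /c /delta invrK lnXn ?ltr0n; last lia.
rewrite (_ : 9 * _ / _ = 18 * ln T%:R * m%:R^-1); last by ring.
by rewrite sqrtrM ?mulr_ge0// sqrtrV.
Qed.

(** Gaps are at most 1, so phase 1 costs at most [T1]. In phase 2 the sum of the square roots of the
    counts is a potential: the two bonuses paid in a round are at most [6 c] times its increase. *)
Lemma pseudo_regret_run_le s t : s \in ord -> (T1 <= t <= T)%N ->
  \sum_(p <- h t) (mu s - mu p.1) <=
    T1%:R + 6 * c * \sum_(s' <- ord) Num.sqrt (cntS (h t) s')%:R
    + T%:R ^- 3 * \sum_(r < t) bad_weight (h r).
Proof.
move=> sord /andP[/subnK <-]; elim: (t - T1)%N => [_|k IH kT].
  rewrite add0n -addrA -[leLHS]addr0 lerD//.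
    rewrite -[X in _ <= X%:R]size_run -sum1_size natr_sum ler_sum// => p _.
    by have := mu01 s; have := mu01 p.1; lra.
  rewrite addr_ge0// !mulr_ge0 ?sqrtr_ge0 ?invr_ge0 ?exprn_ge0// ?sumr_ge0// => r _.
  exact: bad_weight_ge0.
have := IH (ltnW kT); set t' := (k + T1)%N in kT *; rewrite addSn -/t'.
have gap : mu s - mu (choice t') <=
    2 * bonus (cntS (h t') (choice t')) + T%:R ^- 3 * bad_weight (h t').
  apply: ucb_gap_le => // [|s' s'ord]; first by rewrite ltnS leq_addl.
  by apply: cntS_run_bounds => //; rewrite leq_addl ltnW.
have m0 : (0 < cntS (h t') (choice t'))%N.
  suff /andP[] : (0 < cntS (h t') (choice t') <= T)%N by [].
  by apply: cntS_run_bounds; [rewrite leq_addl ltnW|exact: ucb_choice_in].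
(* Only the count of the chosen arm moves, and it moves by one. *)
have inc : \sum_(s' <- ord) Num.sqrt (cntS (h t'.+1) s')%:R =
    \sum_(s' <- ord) Num.sqrt (cntS (h t') s')%:R +
    (Num.sqrt (cntS (h t') (choice t')).+1%:R - Num.sqrt (cntS (h t') (choice t'))%:R) :> R.
  rewrite !(bigD1_seq (choice t'))/= ?ucb_choice_in// cntS_run eqxx addn1.
  rewrite (eq_bigr (fun s' => Num.sqrt (cntS (h t') s')%:R)); first by ring.
  by move=> s' /negbTE; rewrite eq_sym cntS_run => ->; rewrite addn0.
have c0 : 0 <= c by exact: sqrtr_ge0.
have := ler_wpM2l c0 (@invsqrt_le R _ m0).
rewrite big_ord_recr /= inc; have [x ->] := hS t'; rewrite big_rcons /=.
move: gap; rewrite bonusE; lra.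
Qed.

Lemma regret_run_le s : s \in ord ->
  T%:R * mu s - \sum_(p <- h T) p.2 <=
    T1%:R + 6 * c * Num.sqrt ((size ord)%:R * T%:R)
    + T%:R ^- 3 * \sum_(r < T) bad_weight (h r)
    + Num.sqrt T%:R * expR (3 / 2) * expweight (fun=> - (Num.sqrt T%:R)^-1) (h T).
Proof.
move=> sord.
have T0 : 0 < T%:R :> R by rewrite ltr0n; lia.
have q0 : 0 < Num.sqrt T%:R :> R by rewrite sqrtr_gt0.
have -> : T%:R * mu s - \sum_(p <- h T) p.2 =
    \sum_(p <- h T) (mu s - mu p.1) + \sum_(p <- h T) (mu p.1 - p.2).
  rewrite -big_split/=; under [RHS]eq_bigr do rewrite addrA subrK.
  by rewrite big_split/= sumrN big_const_seq count_predT size_run iter_addr_0 mulr_natl.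
apply: lerD.
  apply: (le_trans (pseudo_regret_run_le sord _)); first by rewrite T1T leqnn.
  rewrite lerD2r lerD2l ler_wpM2l ?mulr_ge0 ?sqrtr_ge0//.
  exact: (sum_sqrt_le (sum_cntS_run T)).
set D := \sum_(p <- h T) (mu p.1 - p.2).
(* With slope [-1/sqrt T] the compensator over [T] rounds is exactly [3/2], and [x <= exp x] at
   [x = D / sqrt T] bounds [D] by a multiple of this weight. *)
have -> : expweight (fun=> - (Num.sqrt T%:R)^-1) (h T) = expR (D / Num.sqrt T%:R - 3 / 2).
  congr expR; rewrite big_split/= -mulr_sumr sumrN big_const_seq count_predT size_run.
  rewrite iter_addr_0 sqrrN exprVn sqr_sqrtr ?(ltW T0)// -(mulr_natl (3 / 2 / T%:R)).
  rewrite /D -[\sum_(p <- h T) (mu p.1 - p.2)]opprK -sumrN.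
  under [in RHS]eq_bigr do rewrite opprB.
  have [nz1 nz2] := (lt0r_neq0 T0, lt0r_neq0 q0).
  by field; rewrite nz1 nz2.
rewrite -mulrA -expRD addrC subrK -ler_pdivrMl// mulrC.
by rewrite (le_trans _ (expR_ge1Dx _))// lerDr.
Qed.

End Run.


(** * From pathwise inequalities to bounds in expectation *)

Lemma abs_le_expRDN {R : realType} (x : R) : `|x| <= expR x + expR (- x).
Proof.
have := expR_ge1Dx x; have := expR_ge1Dx (- x).
have := expR_ge0 x; have := expR_ge0 (- x).
by have [x0|x0] := leP 0 x; [rewrite ger0_norm//|rewrite ltr0_norm//]; lra.
Qed.

Section MeanBounded.
Context {d} {T : measurableType d} {R : realType} (P : probability T R).

(** Bundles what the integral of a nonnegative combination of weights requires; the bundle is stable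
    under sums and nonnegative scaling. *)
Definition mean_le (f : T -> R) (b : R) :=
  [/\ measurable_fun setT f, forall w, 0 <= f w & (\int[P]_w (f w)%:E <= b%:E)%E].

Lemma mean_le_cst k : 0 <= k -> mean_le (fun=> k) k.
Proof.
move=> k0; split => //; rewrite integral_cst//.
by rewrite -[leRHS]mule1 lee_wpmul2l ?lee_fin//; exact: probability_le1.
Qed.

Lemma mean_leD f g a b : mean_le f a -> mean_le g b -> mean_le (fun w => f w + g w) (a + b).
Proof.
move=> [mf f0 fa] [mg g0 gb]; split; first exact: measurable_funD.
  by move=> w; rewrite addr_ge0.
under eq_integral do rewrite EFinD.
rewrite ge0_integralD//; first by rewrite EFinD leeD.
- by move=> w _; rewrite lee_fin.
- exact/measurable_EFinP.
- by move=> w _; rewrite lee_fin.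
- exact/measurable_EFinP.
Qed.

Lemma mean_leZ k f a : 0 <= k -> mean_le f a -> mean_le (fun w => k * f w) (k * a).
Proof.
move=> k0 [mf f0 fa]; split; first exact: measurable_funM.
  by move=> w; rewrite mulr_ge0.
under eq_integral do rewrite EFinM.
rewrite ge0_integralZl_EFin//; first by rewrite EFinM lee_wpmul2l ?lee_fin.
- by move=> w _; rewrite lee_fin.
- exact/measurable_EFinP.
Qed.

Lemma mean_le_sum {I : Type} (r : seq I) (f : I -> T -> R) a :
  (forall i, mean_le (f i) a) -> mean_le (fun w => \sum_(i <- r) f i w) ((size r)%:R * a).
Proof.
move=> h; elim: r => [|i r IH].
  by rewrite mul0r; under eq_fun do rewrite big_nil; exact: mean_le_cst.
under eq_fun do rewrite big_cons.
by rewrite /= -nat1r mulrDl mul1r; exact: mean_leD.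
Qed.

Lemma mean_le_sum_ord (n : nat) (f : nat -> T -> R) a :
  (forall i, mean_le (f i) a) -> mean_le (fun w => \sum_(i < n) f i w) (n%:R * a).
Proof.
move=> h; under eq_fun do rewrite -(big_mkord xpredT (f ^~ _)).
by have := mean_le_sum (index_iota 0 n) h; rewrite size_iota subn0.
Qed.

Lemma mean_le_integrable f a : mean_le f a -> P.-integrable setT (EFin \o f).
Proof.
move=> [mf f0 fa]; apply/integrableP; split; first exact/measurable_EFinP.
apply: (@le_lt_trans _ _ a%:E); last exact: ltry.
by under eq_integral do rewrite /= ger0_norm//.
Qed.

(** [Exp] is the [fine] part of an integral, so [V] must first be shown integrable; the dominating
    [g], with any finite bound [b], provides this. *)
Lemma Exp_ge_of_mean_le (V f : T -> R) k a b :
  measurable_fun setT V -> mean_le f a -> (forall w, k - V w <= f w) ->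
  forall g, mean_le g b -> (forall w, `|V w| <= g w) -> k - Exp P V <= a.
Proof.
move=> mV fa kV g gb Vg.
have iV : P.-integrable setT (EFin \o V).
  apply: le_integrable (mean_le_integrable gb) => //; first exact/measurable_EFinP.
  by move=> w _; rewrite lee_fin /= (le_trans (Vg w))// ler_norm.
have if_ := mean_le_integrable fa.
have [_ _ fa'] := fa.
have : (\int[P]_w k%:E <= \int[P]_w ((V w)%:E + (f w)%:E))%E.
  apply: le_integral => //.
  - exact: finite_measure_integrable_cst.
  - exact: integrableD.
  - by move=> w _; rewrite -EFinD lee_fin -lerBlDl.
rewrite integralD// integral_cst// [X in (_ * X)%E]probability_setT mule1.
rewrite /Exp -[X in (X + _)%E]fineK; last exact: integrable_fin_num.
move=> h; rewrite lerBlDl -lee_fin EFinD (le_trans h)// leeD2l//.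
Qed.

End MeanBounded.

Section Expectations.
Context (R : realType) (K N : nat) (Us : finType)
  (S : 'I_N -> {ffun 'I_N -> 'I_K} -> 'M[R]_N -> Us) (H : 'M[R]_N)
  (Y : {ffun 'I_N -> 'I_K} -> 'I_N -> R).
Local Notation arm := {ffun 'I_N -> Us}.
Local Notation mu := (meanY S H Y).
Local Notation expweight := (expweight S H Y).
Hypothesis Y01 : forall A i, 0 <= Y A i <= 1.
Hypothesis N0 : (0 < N)%N.

Lemma meanY01 s : 0 <= mu s <= 1.
Proof.
have [s0|s0] := posnP (size (Defs.preim S H s)).
  rewrite /meanY big1 ?mulr0 ?lexx ?ler01// => i _.
  by rewrite /Ytil (size0nil s0) big_nil mul0r.
have L0 : 0 < (size (Defs.preim S H s))%:R :> R by rewrite ltr0n.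
rewrite -(pmulr_rge0 _ L0) -(ler_pM2l L0 (mu s)) -(sum_Ybar S H Y) mulr1.
rewrite sumr_ge0/= => [|A _]; last by case/andP: (Ybar01 Y01 N0 A).
rewrite -sum1_size natr_sum ler_sum// => A _; by case/andP: (Ybar01 Y01 N0 A).
Qed.

(** Apply [|x| <= e^x + e^-x] to the deviation times [sqrt m], where [m] is the count. The slopes
    [+- 1/sqrt m] make the compensator over [m] pulls equal to [3/2], whence the factor
    [expR (3 / 2)]. *)
Lemma abs_Rhat_le h s l : (0 < cntS h s)%N -> l = (Num.sqrt (cntS h s)%:R)^-1 ->
  `|Rhat h s - mu s| <= expR (3 / 2) * l *
    (expweight (fun s' => if s' == s then l else 0) h +
     expweight (fun s' => if s' == s then - l else 0) h).
Proof.
move=> m0 ->; have m0' : 0 < (cntS h s)%:R :> R by rewrite ltr0n.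
rewrite !expweight_arm; set x := Rhat h s - mu s.
have q0 : 0 < Num.sqrt (cntS h s)%:R :> R by rewrite sqrtr_gt0.
have q2 : Num.sqrt (cntS h s)%:R ^+ 2 = (cntS h s)%:R :> R by rewrite sqr_sqrtr// ltW.
move: q0 q2; set q := Num.sqrt _ => q0 <-.
have -> : q ^+ 2 * (q^-1 * x - 3 / 2 * q^-1 ^+ 2) = q * x - 3 / 2.
  by field; rewrite lt0r_neq0.
have -> : q ^+ 2 * (- q^-1 * x - 3 / 2 * (- q^-1) ^+ 2) = - (q * x) - 3 / 2.
  by field; rewrite lt0r_neq0.
rewrite [expR _ * _]mulrC -mulrA ler_pdivlMl//.
rewrite mulrDr -!expRD ![3 / 2 + _]addrC !subrK.
by rewrite -[X in X * _](gtr0_norm q0) -normrM abs_le_expRDN.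
Qed.

Lemma size_preim_gt0 (Cl : {set {set 'I_N}}) s :
  s \in U_E S H Cl -> (0 < size (Defs.preim S H s))%N.
Proof.
rewrite inE => /andP[_]; rewrite inE => /existsP[A /eqP As].
by rewrite /Defs.preim size_filter -has_count; apply/hasP; exists A; rewrite ?mem_enum ?As.
Qed.

Lemma ATE_meanY s1 s2 : ATE S H Y s1 s2 = mu s1 - mu s2.
Proof. by rewrite /ATE sumrB mulrBr. Qed.

Context {d} {Omega : measurableType d} (P : probability Omega R)
  (eta : 'I_N -> nat -> Omega -> R) (unif : nat -> Omega -> R).
Hypothesis sub_eta : forall i t, subgaussian1 P (eta i t).
Hypothesis unif_unif : forall t, uniform01 P (unif t).
Hypothesis indep : mutually_independent P (fun j : ('I_N * nat) + nat =>
  match j with inl p => eta p.1 p.2 | inr t => unif t end).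

Context (T T1 : nat) (s0 : arm) (ord : seq arm).
Hypotheses (T2 : (1 < T)%N) (T1T : (T1 <= T)%N) (uord : uniq ord) (nT1 : (size ord <= T1)%N)
  (ord0 : ord != [::]) (ordP : forall s, s \in ord -> (0 < size (Defs.preim S H s))%N).
Local Notation hist := (ucb_hist S H Y eta unif T1 (T%:R ^+ 2)^-1 s0 ord).

Let hist0 w : hist 0 w = [::]. Proof. by []. Qed.

Let histS w t : exists x, hist t.+1 w =
  rcons (hist t w) (ucb_choice T1 (T%:R ^+ 2)^-1 s0 ord t.+1 (hist t w), x).
Proof. by eexists; reflexivity. Qed.

Lemma mean_le_expweight lam t : mean_le P (fun w => expweight lam (hist t w)) 1.
Proof.
split.
- by apply: measurable_expweight; exact: (hist_measurableT _ _ _ sub_eta unif_unif).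
- by move=> w; exact: expR_ge0.
- exact: integral_expweight_le1.
Qed.

Lemma integral_Rhat_diff_le s1 s2 : s1 \in ord -> s2 \in ord ->
  (\int[P]_w (`|ATE S H Y s1 s2 - (Rhat (hist T1 w) s1 - Rhat (hist T1 w) s2)|)%:E
    <= (4 * expR (3 / 2) * Num.sqrt (2 * (size ord)%:R / T1%:R))%:E)%E.
Proof.
move=> s1o s2o.
have n0 : (0 < size ord)%N by rewrite lt0n size_eq0.
have T10 : (0 < T1)%N by exact: leq_trans nT1.
pose m s := count (fun r => nth s0 ord (r %% size ord) == s) (iota 0 T1).
(* Round robin ignores the rewards, so the counts after phase 1 are deterministic and the slopes
   [l s] below are constants. *)
have cntE w s : cntS (hist T1 w) s = m s.
  exact: (cntS_round_robin (hist0 w) (histS w)).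
have mge s : s \in ord -> (T1 %/ size ord <= m s)%N.
  move=> so; rewrite -(cntE point).
  exact: (leq_divn_cntS_round_robin (hist0 point) (histS point)).
have q0 : (0 < T1 %/ size ord)%N by rewrite divn_gt0.
have m0 s : s \in ord -> (0 < m s)%N by move=> so; exact: leq_trans (mge s so).
pose l s : R := (Num.sqrt (m s)%:R)^-1.
(* Rounding [T1 / size ord] down loses at most a factor 2, since the quotient is at least 1. *)
have lle s : s \in ord -> l s <= Num.sqrt (2 * (size ord)%:R / T1%:R).
  move=> so; rewrite /l -sqrtrV// ler_sqrt ?divr_ge0 ?mulr_ge0//.
  rewrite -[leRHS]invrK lef_pV2 ?posrE ?invr_gt0 ?divr_gt0 ?mulr_gt0 ?ltr0n ?m0//.
  rewrite invf_div ler_pdivrMr ?mulr_gt0 ?ltr0n// -!natrM ler_nat.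
  have := mge s so; have := ltn_ceil T1 n0; nia.
pose W s w := expR (3 / 2) * l s *
  (expweight (fun s' => if s' == s then l s else 0) (hist T1 w) +
   expweight (fun s' => if s' == s then - l s else 0) (hist T1 w)).
have l0 s : 0 <= l s by rewrite invr_ge0 sqrtr_ge0.
have mW s : mean_le P (W s) (expR (3 / 2) * l s * (1 + 1)).
  apply: mean_leZ; first by rewrite mulr_ge0 ?expR_ge0.
  by apply: mean_leD; exact: mean_le_expweight.
have [mWW _ WW] := mean_leD (mW s1) (mW s2).
have mR s : measurable_fun setT (fun w => Rhat (hist T1 w) s).
  by apply: hist_measurable_Rhat; exact: (hist_measurableT _ _ _ sub_eta unif_unif).
apply: (@le_trans _ _ (\int[P]_w (W s1 w + W s2 w)%:E)%E).
  apply: ge0_le_integral => //.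
  - apply/measurable_EFinP; apply: measurableT_comp => //.
    by apply: measurable_funB => //; exact: measurable_funB.
  - exact/measurable_EFinP.
  - move=> w _; rewrite lee_fin ATE_meanY.
    have := @abs_Rhat_le (hist T1 w) s1 (l s1); rewrite cntE => /(_ (m0 _ s1o) erefl).
    have := @abs_Rhat_le (hist T1 w) s2 (l s2); rewrite cntE => /(_ (m0 _ s2o) erefl).
    rewrite -/(W s1 w) -/(W s2 w) => h2 h1.
    rewrite (le_trans _ (lerD h1 h2))//.
    have -> : mu s1 - mu s2 - (Rhat (hist T1 w) s1 - Rhat (hist T1 w) s2) =
      Rhat (hist T1 w) s2 - mu s2 - (Rhat (hist T1 w) s1 - mu s1) by ring.
    by rewrite [leRHS]addrC; exact: ler_normB.
apply: (le_trans WW); rewrite lee_fin.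
have e0 : 0 <= expR (3 / 2) :> R by exact: expR_ge0.
have := ler_wpM2l e0 (lle s1 s1o); have := ler_wpM2l e0 (lle s2 s2o); lra.
Qed.

Lemma regret_le s : s \in ord ->
  T%:R * mu s - Exp P (fun w => \sum_(p <- hist T w) p.2) <=
    T1%:R + 6 * Num.sqrt (18 * ln T%:R) * Num.sqrt ((size ord)%:R * T%:R)
    + T%:R ^- 3 * (T%:R * ((size ord)%:R * (T.+1%:R * (1 + 1)))) + Num.sqrt T%:R * expR (3 / 2).
Proof.
move=> so.
have mh t : hist_measurable (hist t) by exact: (hist_measurableT _ _ _ sub_eta unif_unif).
have c0 : 0 <= T1%:R + 6 * Num.sqrt (18 * ln T%:R) * Num.sqrt ((size ord)%:R * T%:R) :> R.
  by rewrite addr_ge0// !mulr_ge0 ?sqrtr_ge0.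
have mV : measurable_fun setT (fun w => \sum_(p <- hist T w) p.2).
  by apply: (mh T snd) => s' /=; exact: measurable_id.
have mbad : mean_le P (fun w => \sum_(r < T) bad_weight S H Y T ord (hist r w))
    (T%:R * ((size ord)%:R * (T.+1%:R * (1 + 1)))).
  apply: (@mean_le_sum_ord _ _ _ P T (fun r w => bad_weight S H Y T ord (hist r w))) => r.
  apply: mean_le_sum => s'.
  apply: (@mean_le_sum_ord _ _ _ P T.+1 (fun m w =>
    expweight (fun s1 => if s1 == s' then Num.sqrt (9 * ln (T%:R ^+ 2)^-1^-1 / m%:R) / 3 else 0) (hist r w) +
    expweight (fun s1 => if s1 == s' then
      - (Num.sqrt (9 * ln (T%:R ^+ 2)^-1^-1 / m%:R) / 3) else 0) (hist r w))) => m.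
  by apply: mean_leD; exact: mean_le_expweight.
have k0 : 0 <= Num.sqrt T%:R * expR (3 / 2) :> R by rewrite mulr_ge0 ?sqrtr_ge0 ?expR_ge0.
have k1 : 0 <= (T%:R ^- 3 : R) by rewrite invr_ge0 exprn_ge0.
have mf := mean_leD (mean_leD (mean_le_cst P c0) (mean_leZ k1 mbad))
  (mean_leZ k0 (mean_le_expweight (fun=> - (Num.sqrt T%:R)^-1) T)).
rewrite mulr1 in mf.
(* A crude dominating function for the total reward: the means sum to at most [T], and the centred
   sum is bounded by the weights of slope 1 and -1. Only its finite mean matters. *)
have mg : mean_le P (fun w => T%:R + expR (3 / 2 * T%:R) *
    (expweight (fun=> 1) (hist T w) + expweight (fun=> -1) (hist T w)))
    (T%:R + (expR (3 / 2 * T%:R) * (1 + 1))).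
  apply: mean_leD; first exact: mean_le_cst.
  apply: mean_leZ; first exact: expR_ge0.
  by apply: mean_leD; exact: mean_le_expweight.
apply: (Exp_ge_of_mean_le mV mf _ mg) => w.
  exact: (regret_run_le _ _ _ _ _ meanY01 (hist0 w) (histS w)).
have sT : size (hist T w) = T by exact: (size_run (hist0 w) (histS w)).
have e (l : R) : l ^+ 2 = 1 -> expR (3 / 2 * T%:R) * expweight (fun=> l) (hist T w) =
    expR (l * \sum_(p <- hist T w) (p.2 - mu p.1)).
  move=> l2; rewrite /expweight -expRD; congr expR.
  rewrite big_split/= -mulr_sumr sumrN big_const_seq count_predT sT iter_addr_0 l2.
  by rewrite -(mulr_natl (3 / 2 * 1)); ring.
rewrite mulrDr !e ?sqrrN ?expr1n// mul1r mulN1r.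
rewrite -[X in `|X|](subrK (\sum_(p <- hist T w) mu p.1)) -sumrB addrC.
rewrite (le_trans (ler_normD _ _))// lerD ?abs_le_expRDN//.
rewrite ger0_norm ?sumr_ge0//; last by move=> p _; case/andP: (meanY01 p.1).
rewrite -[X in _ <= X%:R]sT -sum1_size natr_sum ler_sum// => p _.
by case/andP: (meanY01 p.1).
Qed.

End Expectations.


(** * Balancing the estimation error against the regret *)

Lemma ln_ge_half {R : realType} (T : nat) : (1 < T)%N -> 2^-1 <= ln T%:R :> R.
Proof.
move=> T2; rewrite -ler_expR lnK ?posrE ?ltr0n; last lia.
apply: (@le_trans _ _ 2); last by rewrite ler_nat.
have h : 2^-1 <= expR (- 2^-1) :> R by rewrite (le_trans _ (expR_ge1Dx _))//; lra.
by rewrite -[leLHS]invrK -expRN -[leRHS]invrK lef_pV2 ?posrE ?expR_gt0.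
Qed.

(** The regret bound is at most a constant times [T1 (ln T)^2], since [T1] dominates both
    [sqrt(n T)] and [sqrt T]; the square root of [T1] then cancels against the error bound. *)
Lemma error_regret_tradeoff {R : realType} (n T T1 : nat) : (2 <= n <= T)%N ->
  Num.sqrt (n%:R * T%:R) <= T1%:R :> R ->
  4 * expR (3 / 2) * Num.sqrt (2 * n%:R / T1%:R) *
  Num.sqrt (T1%:R + 6 * Num.sqrt (18 * ln T%:R) * Num.sqrt (n%:R * T%:R)
    + T%:R ^- 3 * (T%:R * (n%:R * (T.+1%:R * (1 + 1)))) + Num.sqrt T%:R * expR (3 / 2)) <=
  4 * expR (3 / 2) * Num.sqrt (2 * (84 + 4 * expR (3 / 2))) * Num.sqrt n%:R * ln T%:R :> R.
Proof.
move=> /andP[n2 nT] T1ge; have lT := @ln_ge_half R T (leq_trans n2 nT).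
set l := ln T%:R in lT *; set e := expR (3 / 2).
have e0 : 0 <= e by exact: expR_ge0.
have n2R : 2 <= n%:R :> R by rewrite ler_nat.
have nTR : n%:R <= T%:R :> R by rewrite ler_nat.
have sTT1 : Num.sqrt T%:R <= T1%:R :> R.
  by apply: le_trans T1ge; rewrite ler_sqrt ?mulr_ge0//; nra.
have T1ge2 : 2 <= T1%:R :> R.
  apply: le_trans T1ge.
  by rewrite -[leLHS]ger0_norm// -sqrtr_sqr ler_sqrt ?mulr_ge0//; nra.
set b := (X in _ * Num.sqrt X <= _); set T1R := T1%:R in sTT1 T1ge2 T1ge b *.
clearbody e l T1R.
have bound4 : T%:R ^- 3 * (T%:R * (n%:R * (T.+1%:R * (1 + 1)))) <= 4 :> R.
  rewrite ler_pdivrMl ?exprn_gt0//; last lra.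
  rewrite -natr1; move: n2R nTR; set x := n%:R; set y := T%:R => x2 xy.
  have : x * (y * (y + 1)) <= y * (y * (y + 1)) by rewrite ler_wpM2r// mulr_ge0; lra.
  have : 0 <= y ^+ 2 * (y - 1) by rewrite mulr_ge0 ?sqr_ge0//; lra.
  nra.
have l22 : 0 <= (l - 2^-1) * (l - 2^-1) by rewrite mulr_ge0//; lra.
have sl : Num.sqrt (18 * l) <= 6 * l.
  by rewrite -[leRHS]ger0_norm -?sqrtr_sqr ?ler_sqrt ?sqr_ge0//; nra.
have l0 : 0 <= l by lra.
have k0 : 0 <= 84 + 4 * e by lra.
(* The constant term 4 is at most [2 T1], so the terms without logarithm sum to at most
   [T1 (3 + e)]. Then [1 <= 4 l^2] and [l <= 2 l^2] give [12 + 4 e] and [6 * 6 * 2 = 72]. *)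
have bT1 : b <= T1R * ((84 + 4 * e) * l ^+ 2).
  have h1 : Num.sqrt (18 * l) * Num.sqrt (n%:R * T%:R) <= 6 * l * T1R.
    by rewrite ler_pM ?sqrtr_ge0.
  have h2 : Num.sqrt T%:R * e <= T1R * e by rewrite ler_wpM2r.
  have l1 : 1 <= 4 * l ^+ 2 by lra.
  have l2 : l <= 2 * l ^+ 2 by lra.
  have h3 : T1R * (3 + e) <= T1R * (3 + e) * (4 * l ^+ 2).
    by rewrite ler_peMr// mulr_ge0//; lra.
  have h4 : T1R * l <= T1R * (2 * l ^+ 2) by rewrite ler_wpM2l//; lra.
  rewrite /b; set y4 := T%:R ^- 3 * _ in bound4 *; lra.
have -> : 4 * e * Num.sqrt (2 * (84 + 4 * e)) * Num.sqrt n%:R * l =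
    4 * e * (Num.sqrt (2 * (84 + 4 * e)) * Num.sqrt n%:R * l) by rewrite -!mulrA.
rewrite -[leLHS]mulrA ler_wpM2l ?mulr_ge0// -sqrtrM ?divr_ge0 ?mulr_ge0//; last lra.
have -> : Num.sqrt (2 * (84 + 4 * e)) * Num.sqrt n%:R * l =
    Num.sqrt (2 * (84 + 4 * e) * n%:R * l ^+ 2).
  by rewrite [RHS]sqrtrM ?mulr_ge0// sqrtr_sqr (ger0_norm l0) [in RHS]sqrtrM ?mulr_ge0//.
rewrite ler_sqrt ?mulr_ge0 ?sqr_ge0//.
rewrite [leRHS](_ : _ = 2 * n%:R / T1R * (T1R * ((84 + 4 * e) * l ^+ 2))).
  by rewrite ler_wpM2l// divr_ge0 ?mulr_ge0//; lra.
field; lra.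
Qed.

Theorem theorem5 (R : realType) :
  exists (C : R) (c : nat), 0 < C /\
  forall (K N : nat) (Us : finType)
    (S : 'I_N -> {ffun 'I_N -> 'I_K} -> 'M[R]_N -> Us) (H : 'M[R]_N)
    (Cl : {set {set 'I_N}}),
  finset.partition Cl [set: 'I_N] ->
  forall (T T1 : nat),
  (2 <= #|U_E S H Cl| <= T)%N ->
  (T1 <= T)%N ->
  Num.sqrt (#|U_E S H Cl|%:R * T%:R : R) <= T1%:R ->
  forall (ord : seq {ffun 'I_N -> Us}), perm_eq ord (enum (U_E S H Cl)) ->
  forall (s0 : {ffun 'I_N -> Us}),
  (* the instance nu: mean rewards Y and the noise / sampling randomness *)
  forall (Y : {ffun 'I_N -> 'I_K} -> 'I_N -> R),
  (forall A i, 0 <= Y A i <= 1) ->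
  forall (d : measure_display) (Omega : measurableType d)
    (P : probability Omega R)
    (eta : 'I_N -> nat -> Omega -> R) (unif : nat -> Omega -> R),
  (forall i t, subgaussian1 P (eta i t)) ->
  (forall i t i' t' (B : set R), measurable B ->
      P (eta i t @^-1` B) = P (eta i' t' @^-1` B)) ->
  (forall t, uniform01 P (unif t)) ->
  mutually_independent P
    (fun j : ('I_N * nat) + nat =>
       match j with inl p => eta p.1 p.2 | inr t => unif t end) ->
  forall Sstar : {ffun 'I_N -> Us}, Sstar \in U_E S H Cl ->
  (forall s, s \in U_E S H Cl -> meanY S H Y s <= meanY S H Y Sstar) ->
  let delta : R := (T%:R ^+ 2)^-1 in
  let hist := ucb_hist S H Y eta unif T1 delta s0 ord in
  let regret : R :=
    T%:R * meanY S H Y Sstar - Exp P (fun w => \sum_(p <- hist T w) p.2) in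
  let err : \bar R :=
    (\big[maxe/0%E]_(s1 in U_E S H Cl) \big[maxe/0%E]_(s2 in U_E S H Cl)
       \int[P]_w (`| ATE S H Y s1 s2
                    - (Rhat (hist T1 w) s1 - Rhat (hist T1 w) s2) |)%:E)%E in
  (err * (Num.sqrt regret)%:E <=
     (C * Num.sqrt (#|U_E S H Cl|%:R) * (ln (T%:R)) ^+ c)%:E)%E.
Proof.
exists (4 * expR (3 / 2) * Num.sqrt (2 * (84 + 4 * expR (3 / 2)))), 1%N; split.
  by rewrite !mulr_gt0 ?expR_gt0// sqrtr_gt0 mulr_gt0// addr_gt0// mulr_gt0 ?expR_gt0.
move=> K N Us S H Cl _ T T1 /[dup] nT /andP[n2 nT'] T1T T1ge ord ordE s0 Y Y01 d Omega P eta unif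
  sub_eta _ unifU indep Sstar Sstar_in _.
cbv zeta; set err := (X in (X * _)%E); set regret := (X in Num.sqrt X).
(* Without units there is a single exposure vector, against [2 <= #|U_E S H Cl|]. *)
have N0 : (0 < N)%N.
  rewrite lt0n; apply/eqP => N0.
  have := leq_trans n2 (max_card (mem (U_E S H Cl))).
  by rewrite card_ffun card_ord N0 expn0.
have sord : size ord = #|U_E S H Cl| by rewrite (perm_size ordE) -cardE.
have ordin s : (s \in ord) = (s \in U_E S H Cl) by rewrite (perm_mem ordE) mem_enum.
have uord : uniq ord by rewrite (perm_uniq ordE) enum_uniq.
have ord0 : ord != [::] by rewrite -size_eq0 sord; lia.
have ordP s : s \in ord -> (0 < size (Defs.preim S H s))%N.
  by rewrite ordin; exact: size_preim_gt0.
(* As [n <= T], also [n <= sqrt(n T) <= T1]: phase 1 pulls every arm at least once. *)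
have nT1 : (size ord <= T1)%N.
  rewrite sord -(ler_nat R); apply: le_trans T1ge.
  rewrite -[leLHS]ger0_norm// -sqrtr_sqr ler_sqrt ?mulr_ge0// expr2.
  by rewrite ler_wpM2l// ler_nat.
have T2 : (1 < T)%N by exact: leq_trans n2 nT'.
rewrite expr1.
pose a : R := 4 * expR (3 / 2) * Num.sqrt (2 * (#|U_E S H Cl|)%:R / T1%:R).
have err_le : (err <= a%:E)%E.
  apply: (big_ind (fun x => x <= a%:E)%E) => [|x y|s1 s1in].
  - by rewrite lee_fin !mulr_ge0 ?expR_ge0.
  - by rewrite ge_max => -> ->.
  apply: (big_ind (fun x => x <= a%:E)%E) => [|x y|s2 s2in].
  - by rewrite lee_fin !mulr_ge0 ?expR_ge0.
  - by rewrite ge_max => -> ->.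
  rewrite /a -sord.
  by apply: (integral_Rhat_diff_le Y01 N0 sub_eta unifU indep) => //; rewrite ordin.
have err0 : (0 <= err)%E.
  apply: (big_ind (fun x => 0 <= x)%E) => [//|x y x0 y0|s1 _]; first by rewrite le_max x0.
  apply: (big_ind (fun x => 0 <= x)%E) => [//|x y x0 y0|s2 _]; first by rewrite le_max x0.
  by apply: integral_ge0 => w _; rewrite lee_fin.
have Sord : Sstar \in ord by rewrite ordin.
have := regret_le Y01 N0 sub_eta unifU indep s0 T2 T1T uord nT1 ord0 ordP Sord.
rewrite sord => regret_le.
have := ler_wsqrtr regret_le; rewrite -lee_fin => sqrt_le.
apply: le_trans (lee_pmul err0 _ err_le sqrt_le) _.
  by rewrite lee_fin sqrtr_ge0.
by rewrite -EFinM lee_fin; exact: error_regret_tradeoff.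
Qed.
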